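(* If $X$ is a compact geodesic space, then $\mathrm{CS}\subset\mathrm{ECS}$, where $\mathrm{CS}$ is the covering spectrum of $X$ and $\mathrm{ECS}$ is the extended covering spectrum of $X$.
   Context: A geodesic space is a metric space $(X,d)$ in which any two points $x,y$ are joined by a curve of length $d(x,y)$. Covering spectrum (Sormani--Wei): for $\delta>0$ the $\delta$-cover of $X$ is the regular covering of $X$ whose fundamental group has image in $\pi_1(X)$ the normal subgroup generated by classes of loops $\alpha\ast\lambda\ast\overline{\alpha}$, where $\alpha$ starts at the basepoint and $\lambda$ is a loop lying in an open ball $B(x,\delta)$. $\mathrm{CS}$ is the set of values $\delta>0$ at which the equivalence type of the $\delta$-covers changes, i.e. such that the $\delta$-cover is not equivalent to the $\delta'$-cover for any $\delta'>\delta$. An entourage in $X$ is a symmetric subset $E\subset X\times X$ containing $E_\varepsilon:=\{(x,y):d(x,y)<\varepsilon\}$ for some $\varepsilon>0$. $B(x,E):=\{y:(x,y)\in E\}$. An $E$-chain is a finite sequence $\{x_0,\dots,x_n\}$ with $(x_i,x_{i+1})\in E$ for all $i$. An $E$-homotopy between $E$-chains is a finite sequence of $E$-chains with the same endpoints, each obtained from the previous one by inserting or removing a single point (never an endpoint), every step remaining an $E$-chain; $[\alpha]_E$ is the $E$-homotopy class of $\alpha$ (a chain $\{x,x\}$ is identified with $\{x\}$). Concatenation is $\ast$, reversal is $\overline{\alpha}$. $E$ is chained if $E$ is contained in the closure of its interior and whenever $(x,y)\in E$ and $F$ is an entourage, $x,y$ can be joined by an $F$-chain lying in $B(x,E)\cap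 B(y,E)$. Fix a basepoint $\ast\in X$. $X_E$ is the set of classes $[\alpha]_E$ of $E$-chains starting at $\ast$, and $\phi_E:X_E\to X$ sends $[\alpha]_E$ to the endpoint of $\alpha$. For an entourage $F\subset E$, $F^\ast$ is the set of pairs $([\alpha]_E,[\beta]_E)$ with endpoints $x,y$ such that $(x,y)\in F$ and $[\overline{\alpha}\ast\beta]_E=[\{x,y\}]_E$; the balls $B(\cdot,F^\ast)$ form a basis of the topology of $X_E$, for which $\phi_E$ is a regular covering map. An entourage cover is a $\phi_E$ with $E$ chained. Two covers of $X$ are equivalent if there is a homeomorphism between the total spaces commuting with the projections to $X$. $\sigma(E):=\sup\{\varepsilon>0:E_\varepsilon\subset E\}$. $NC(\varepsilon)$ is the number of equivalence classes of entourage covers $\phi_E$ with $\sigma(E)\ge\varepsilon$; it is finite and does not decrease as $\varepsilon$ decreases. $\mathrm{ECS}$ is the set of $\varepsilon>0$ at which $NC$ strictly increases, i.e. $NC(\varepsilon)>NC(\delta)$ for all $\delta>\varepsilon$.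
   Formalization: The inclusion proved is (2/3)·CS ⊂ ECS: with the δ-covers defined by open balls B(x,δ), the unscaled inclusion fails for a circle of length L, where CS = {L/2} but ECS = {L/3}. *)

(* Defs.v *)
From HB Require Import structures.
From Stdlib Require Import Relation_Operators.
From mathcomp Require Import all_boot all_order all_algebra generic_quotient.
From mathcomp Require Import finmap.
From mathcomp Require Import all_classical all_reals all_analysis.

Set Implicit Arguments.
Unset Strict Implicit.
Unset Printing Implicit Defensive.

Import Order.TTheory GRing.Theory Num.Theory.
Import numFieldTopology.Exports.

Local Open Scope classical_set_scope.
Local Open Scope ring_scope.
Local Open Scope quotient_scope.

(* Paths are functions R -> T of which only the restriction to `[0, 1] is     *)
(* meaningful.                                                                *)
Definition is_path (R : realType) (T : topologicalType) (x y : T)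
    (f : R -> T) : Prop :=
  [/\ {within `[0, 1], continuous f}, f 0 = x & f 1 = y].

(* [s] lists the partition points after 0, cf. [itv_partition] and            *)
(* [variation], of which this is the analogue for metric-valued functions.    *)
Definition path_length (R : realType) (X : metricType R) (f : R -> X)
    : \bar R :=
  ereal_sup [set (\sum_(0 <= i < size s)
      mdist (f (nth 1 (0 :: s) i)) (f (nth 1 (0 :: s) i.+1)))%:E
    | s in itv_partition 0 1].

Definition geodesic (R : realType) (X : metricType R) : Prop :=
  forall x y : X, exists2 f : R -> X,
    is_path x y f & path_length f = (mdist x y)%:E.

Definition evenly_covered (Y X : topologicalType) (p : Y -> X) (U : set X)
    : Prop :=
  exists S : set (set Y),
    [/\ p @^-1` U = \bigcup_(V in S) V,
        trivIset S id &
        forall V, S V ->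
          [/\ open V, set_bij V U p &
              forall W, open W -> W `<=` V -> open (p @` W)]].

Definition covering_map (Y X : topologicalType) (p : Y -> X) : Prop :=
  [/\ continuous p, range p = [set: X] &
      forall x, exists U, [/\ open U, U x & evenly_covered p U]].

Definition cover_equiv (X Y Z : topologicalType) (p : Y -> X) (q : Z -> X)
    : Prop :=
  exists (f : Y -> Z) (g : Z -> Y),
    [/\ continuous f, continuous g, cancel f g, cancel g f & q \o f =1 p].

Section Paths.
Variables (R : realType) (T : topologicalType).
Implicit Types f g : R -> T.

Definition path_cat f g : R -> T :=
  fun t => if t <= 2^-1 then f (2 * t) else g (2 * t - 1).

Definition path_rev f : R -> T := fun t => f (1 - t).

(* Homotopy relative to the endpoints; the first variable is the time of the  *)
(* homotopy.                                                                  *)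
Definition path_homotopic (x y : T) f g : Prop :=
  exists H : R * R -> T,
    [/\ {within `[0, 1] `*` `[0, 1], continuous H},
        forall t, 0 <= t <= 1 -> H (0, t) = f t /\ H (1, t) = g t &
        forall s, 0 <= s <= 1 -> H (s, 0) = x /\ H (s, 1) = y].

End Paths.

(* A subgroup of pi_1(X, b) is represented by the predicate, on loops at b,   *)
(* that the class of the loop belongs to the subgroup.  The following is the  *)
(* normal subgroup generated by the classes of the loops alpha * lambda *     *)
(* alpha^-1 with lambda in an open ball of radius delta.                      *)
Inductive delta_subgroup (R : realType) (X : metricType R) (b : X) (delta : R)
    : (R -> X) -> Prop :=
| delta_gen (x z : X) (alpha lambda : R -> X) :
    is_path b x alpha -> is_path x x lambda ->
    (forall t, 0 <= t <= 1 -> ball z delta (lambda t)) ->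
    delta_subgroup b delta
      (path_cat (path_cat alpha lambda) (path_rev alpha))
| delta_one : delta_subgroup b delta (cst b)
| delta_mul f g :
    delta_subgroup b delta f -> delta_subgroup b delta g ->
    delta_subgroup b delta (path_cat f g)
| delta_inv f : delta_subgroup b delta f -> delta_subgroup b delta (path_rev f)
| delta_conj h f :
    is_path b b h -> delta_subgroup b delta f ->
    delta_subgroup b delta (path_cat (path_cat h f) (path_rev h))
| delta_homotopic f g :
    is_path b b f -> is_path b b g -> path_homotopic b b f g ->
    delta_subgroup b delta f -> delta_subgroup b delta g.

(* The image of pi_1(Y, y) in pi_1(X, b) is [delta_subgroup b delta]; since   *)
(* the latter is normal, such a covering is regular.                          *)
Definition is_delta_cover (R : realType) (X : metricType R) (b : X)
    (delta : R) (Y : topologicalType) (p : Y -> X) : Prop :=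
  [/\ covering_map p, connected [set: Y] &
      exists2 y : Y, p y = b &
        forall f : R -> X, is_path b b f ->
          (delta_subgroup b delta f <->
           exists2 h : R -> Y, is_path y y h & path_homotopic b b (p \o h) f)].

Definition delta_covers_equiv (R : realType) (X : metricType R) (b : X)
    (delta delta' : R) : Prop :=
  exists (Y Y' : topologicalType) (p : Y -> X) (p' : Y' -> X),
    [/\ is_delta_cover b delta p, is_delta_cover b delta' p' &
        cover_equiv p p'].

(* On a compact geodesic space the delta-cover is the entourage cover of      *)
(* [eps_entourage (2 / 3 * delta)]: a loop of length < 3 * e lies in a ball   *)
(* of radius 3 / 2 * e, and is null for [eps_entourage e] since it can be cut *)
(* into three arcs of length < e.  Hence the covering spectrum has to be      *)
(* rescaled by 2 / 3 before it is compared with a spectrum defined from       *)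
(* entourages: a circle of length L has covering spectrum {L / 2} and         *)
(* extended covering spectrum {L / 3}.                                        *)
Definition covering_spectrum (R : realType) (X : metricType R) (b : X)
    : set R :=
  [set delta | 0 < delta /\
    forall delta', delta < delta' -> ~ delta_covers_equiv b delta delta'].

Definition eps_entourage (R : realType) (X : metricType R) (e : R)
    : set (X * X) := [set xy | mdist xy.1 xy.2 < e].

(* The uniform structure of X is the filter of sets that contain some         *)
(* [eps_entourage e], 0 < e ([entourage_from_ballE]).                         *)
Record sym_entourage (R : realType) (X : metricType R) := SymEntourage {
  ent_set :> set (X * X);
  ent_sym : forall x y, ent_set (x, y) -> ent_set (y, x);
  ent_entourage : entourage ent_set }.

Section DiscreteHomotopy.
Variables (R : realType) (X : metricType R).
Implicit Types (E F : sym_entourage X) (s t u v : seq X).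

Definition ent_ball E (x : X) : set X := [set y | ent_set E (x, y)].

Definition ent_chain E s : Prop :=
  s <> [::] /\ sorted [rel x y | (x, y) \in ent_set E] s.

(* Insertion of one point, other than an endpoint; the second alternative     *)
(* identifies {x, x} with {x}.                                                *)
Definition insert_step E s t : Prop :=
  [/\ ent_chain E s, ent_chain E t &
      (exists u x v,
         [/\ u <> [::], v <> [::], s = u ++ v & t = u ++ x :: v]) \/
      (exists x, s = [:: x] /\ t = [:: x; x])].

Definition ent_homotopic E : seq X -> seq X -> Prop :=
  clos_refl_sym_trans _ (insert_step E).

Definition chained E : Prop :=
  [/\ ent_set E `<=` closure (interior (ent_set E)) &
      forall x y (F : sym_entourage X), ent_set E (x, y) ->
        exists s, [/\ ent_chain F (x :: s), last x s = y &
          forall z, z \in x :: s -> (ent_ball E x `&` ent_ball E y) z]].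

Definition sigma E : \bar R :=
  ereal_sup [set e%:E | e in
    [set e | 0 < e /\ eps_entourage e `<=` ent_set E]].

Definition based_chain E (b : X) :=
  {s : seq X | `[< ent_chain E s /\ head b s = b >]}.

End DiscreteHomotopy.

Section EntourageCover.
Variables (R : realType) (X : metricType R) (E : sym_entourage X) (b : X).

Definition based_homotopicb (a a' : based_chain E b) : bool :=
  `[< ent_homotopic E (val a) (val a') >].

Lemma based_homotopicb_refl : reflexive based_homotopicb.
Proof. by move=> a; apply/asboolP; exact: rst_refl. Qed.

Lemma based_homotopicb_sym : symmetric based_homotopicb.
Proof.
by move=> a a'; apply/asboolP/asboolP => ?; exact: rst_sym.
Qed.

Lemma based_homotopicb_trans : transitive based_homotopicb.
Proof.
move=> a1 a0 a2 /asboolP h1 /asboolP h2; apply/asboolP.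
exact: rst_trans h1 h2.
Qed.

Definition based_homotopy : equiv_rel (based_chain E b) :=
  EquivRel based_homotopicb based_homotopicb_refl based_homotopicb_sym
    based_homotopicb_trans.

Definition ent_cover := {eq_quot based_homotopy}.

HB.instance Definition _ := Choice.on ent_cover.
HB.instance Definition _ := Quotient.on ent_cover.

Definition ent_proj (q : ent_cover) : X := last b (val (repr q)).

(* For alpha, beta starting at b, the concatenation of the reversal of alpha  *)
(* with beta is [rev alpha ++ behead beta]: the common point b is not         *)
(* repeated.                                                                  *)
Definition ent_star (F : sym_entourage X) : set (ent_cover * ent_cover) :=
  [set qq | exists alpha beta : based_chain E b,
    let x := last b (val alpha) in let y := last b (val beta) in
    [/\ \pi_ent_cover alpha = qq.1, \pi_ent_cover beta = qq.2,
        ent_set F (x, y) &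
        ent_homotopic E (rev (val alpha) ++ behead (val beta)) [:: x; y]]].

Definition star_ball (F : sym_entourage X) (q : ent_cover) : set ent_cover :=
  [set q' | ent_star F (q, q')].

(* The sets [star_ball F q], F ranging over the entourages contained in E,    *)
(* form a basis of neighbourhoods of q.                                       *)
Definition cover_open : set_system ent_cover :=
  [set U | forall q, U q -> exists F : sym_entourage X,
    ent_set F `<=` ent_set E /\ star_ball F q `<=` U].

Lemma cover_openT : cover_open setT.
Proof. by move=> q _; exists E; split. Qed.

Lemma star_ballS (F G : sym_entourage X) q :
  ent_set F `<=` ent_set G -> star_ball F q `<=` star_ball G q.
Proof.
by move=> FG q' [a [a' [? ? /FG ? ?]]]; exists a, a'; split.
Qed.

Lemma cover_openI : setI_closed cover_open.
Proof.
move=> U V oU oV q [/oU[F [FE FU]] /oV[G [GE GV]]].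
have symFG x y : (ent_set F `&` ent_set G) (x, y) ->
    (ent_set F `&` ent_set G) (y, x).
  by move=> [? ?]; split; exact: ent_sym.
exists (SymEntourage symFG (filterI (ent_entourage F) (ent_entourage G))).
split=> [xy [/FE]//|q' h]; split.
- by apply: FU; apply: star_ballS h => ? [].
- by apply: GV; apply: star_ballS h => ? [].
Qed.

Lemma cover_open_bigU (I : Type) (f : I -> set ent_cover) :
  (forall i, cover_open (f i)) -> cover_open (\bigcup_i f i).
Proof.
move=> of_ q [i _ /of_[F [FE Fq]]]; exists F; split=> //.
by move=> q' /Fq ?; exists i.
Qed.

HB.instance Definition _ := isOpenTopological.Build ent_cover
  cover_openT cover_openI cover_open_bigU.

Lemma insert_step_last s t : insert_step E s t -> last b s = last b t.
Proof.
case=> _ _ [[u [x [v [u0 v0 -> ->]]]]|[x [-> ->]]] //.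
by case: v v0 => [//|y v] _; rewrite !last_cat.
Qed.

Lemma ent_projE (alpha : based_chain E b) :
  ent_proj (\pi_ent_cover alpha) = last b (val alpha).
Proof.
have /eqmodP/asboolP : repr (\pi_ent_cover alpha) = alpha %[mod ent_cover].
  by rewrite reprK.
rewrite /ent_proj; elim => [s t|//|s t _ ->|s t u _ -> _ ->] //.
exact: insert_step_last.
Qed.

End EntourageCover.

Section ExtendedCoveringSpectrum.
Variables (R : realType) (X : metricType R) (b : X).

Definition ent_cover_class (E : sym_entourage X) : set (sym_entourage X) :=
  [set F | chained F /\ cover_equiv (@ent_proj R X E b) (@ent_proj R X F b)].

Definition cover_classes (e : R) : set (set (sym_entourage X)) :=
  [set ent_cover_class E | E in
    [set E | chained E /\ (e%:E <= sigma E)%E]].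

(* [fset_set A] is junk (empty) for infinite A; [cover_classes e] is finite   *)
(* for 0 < e when X is a compact geodesic space.                              *)
Definition NC (e : R) : nat := #|` fset_set (cover_classes e)|.

Definition extended_covering_spectrum : set R :=
  [set e | 0 < e /\ forall delta, e < delta -> (NC delta < NC e)%N].

End ExtendedCoveringSpectrum.

(* Main.v *)
(* A loop in a ball of radius [3 / 2 * r] is null for the entourage           *)
(* [E_r = {d < r}]: cone it off from the centre of the ball, through the      *)
(* points at two thirds of the radii, using triangles with sides [< r].       *)
(* Conversely, a geodesic triangle with sides [< r] lies in a ball of radius  *)
(* [3 / 2 * r] centred at a vertex.  Hence the delta-subgroup for             *)
(* [delta = 3 / 2 * r] consists of the loops whose fine subdivisions are      *)
(* [E_r]-null, and the cover of [E_r] is the delta-cover.  If its class       *)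
(* already appeared for some [e > r], it would be the class of a chained      *)
(* entourage containing [E_m] for some [m > r], so loops in balls of radius   *)
(* [3 / 2 * m] would be [E_r]-null and the cover would be a delta'-cover for  *)
(* [delta' = 3 / 2 * m] too, which membership in the covering spectrum rules  *)
(* out.  The number of classes jumps at [r] since these numbers are finite:   *)
(* if [E] is chained and contains [E_(3 s)], pairs in [E] can be joined by    *)
(* [E_s]-chains of bounded length inside an [E]-ball, so that the cover of    *)
(* [E] is determined by the short chains of points of a finite net that are   *)
(* [E]-null loops.                                                            *)

From Stdlib Require Import Relation_Operators.
Require Import Defs.
From mathcomp Require Import all_boot all_order all_algebra generic_quotient.
From mathcomp Require Import all_classical all_reals all_analysis.
From mathcomp Require Import lra.

Set Implicit Arguments.
Unset Strict Implicit.
Unset Printing Implicit Defensive.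

Import Order.TTheory GRing.Theory Num.Theory.
Import numFieldTopology.Exports.

Local Open Scope classical_set_scope.
Local Open Scope ring_scope.

(** * Chain homotopies *)

Section ChainHomotopy.
Variables (R : realType) (X : metricType R) (E : sym_entourage X).
Implicit Types (s t u v : seq X) (x y z w : X).

(** Path lifting is the bridge between chains and loops. Appending to a class a point that is
    [E]-close to its endpoint ([ext]) gives local sections of the cover of [E]. Hence paths lift,
    and a loop at [b] lifts to a closed loop from the trivial class exactly when its fine
    subdivision is an [E]-null chain ([lifts_discP]).

    For [E_r] and d = 3 / 2 * r, loops in balls of radius d have closed lifts ([lifts_ball]), and
    closed lifts survive products, conjugation and homotopy, so the whole delta-subgroup lifts to
    closed loops ([delta_lifts]). Conversely a null homotopy of chains is a succession of geodesic
    triangles, each inside a ball of radius d, so a loop with a closed lift lies in the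
    delta-subgroup ([lifts_delta]). Thus the cover of [E_r] is the d-cover ([delta_cover]).

    If d is in the covering spectrum, the class of this cover is realised by no chained [E] with
    [sigma E] at least some e > r: such an [E] contains [E_m] for some m in between, which would
    make the d-cover a 3 / 2 * m-cover as well ([spectrum_new_class]). So the set of classes grows
    strictly at r. Its cardinality does too ([NC_lt]), because the sets of classes are finite
    ([cover_classes_finite]): the cover of [E] is determined by which short chains in a finite net
    are [E]-null ([net_null_equiv]). *)

Definition ent_rel : rel X := [rel x y | (x, y) \in ent_set E].
Arguments ent_rel : simpl never.

Lemma ent_relP x y : reflect (ent_set E (x, y)) (ent_rel x y).
Proof. by rewrite /ent_rel; apply: (iffP idP) => /=; rewrite inE. Qed.

Lemma ent_rel_sym : symmetric ent_rel.
Proof. by move=> x y; apply/ent_relP/ent_relP => /ent_sym. Qed.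

Lemma ent_rel_refl : reflexive ent_rel.
Proof.
by move=> x; apply/ent_relP; exact: (entourage_refl _ (ent_entourage E)).
Qed.

Lemma ent_chain_cons x s : ent_chain E (x :: s) <-> path ent_rel x s.
Proof. by split=> [[]|]. Qed.

Lemma ent_chain_cat u x v :
  ent_chain E (u ++ x :: v) <-> ent_chain E (rcons u x) /\ path ent_rel x v.
Proof.
rewrite /ent_chain sorted_cat_cons; split=> [[_ /andP[? ?]]|[[_ ?] ?]].
  by split=> //; split=> //; case: (u).
by split; [case: (u)|apply/andP].
Qed.

Lemma ent_chain_catA u x s v :
  ent_chain E (u ++ x :: s ++ v) <->
  [/\ ent_chain E (rcons u x), path ent_rel x s & path ent_rel (last x s) v].
Proof.
rewrite ent_chain_cat cat_path; split=> [[? /andP[? ?]]|[? ? ?]] //.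
by split=> //; apply/andP.
Qed.

Lemma ent_chain_rev s : ent_chain E s -> ent_chain E (rev s).
Proof.
move=> [s0 ss]; split; first by case: s s0 {ss} => // x s _; rewrite rev_cons;
  case: rev.
rewrite rev_sorted; apply: (@sub_sorted _ ent_rel) ss => x y.
by rewrite ent_rel_sym.
Qed.

Local Notation hom := (ent_homotopic E).

Lemma hom_refl s : hom s s. Proof. exact: rst_refl. Qed.
Lemma hom_sym s t : hom s t -> hom t s. Proof. exact: rst_sym. Qed.
Lemma hom_trans t s u : hom s t -> hom t u -> hom s u.
Proof. exact: rst_trans. Qed.

Lemma insert_step_ends x s t : insert_step E s t ->
  head x s = head x t /\ last x s = last x t.
Proof.
case=> _ _ [[u [y [v [u0 v0 -> ->]]]]|[y [-> ->]]] //.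
by case: u u0 v v0 => // a u _ [|c v] //= _; rewrite !last_cat.
Qed.


Lemma ent_chain_subst u s t v x :
  ent_chain E s -> ent_chain E t -> head x s = head x t ->
    last x s = last x t ->
  ent_chain E (u ++ s ++ v) -> ent_chain E (u ++ t ++ v).
Proof.
case: s t => [|y s] [|z t] //=; try by move=> [/(_ erefl)].
  by move=> _ [/(_ erefl)].
move=> /ent_chain_cons ps /ent_chain_cons pt xz; rewrite -xz in pt *;
  move=> lst.
by rewrite !ent_chain_catA => -[? _ ?]; rewrite -lst.
Qed.

Lemma insert_step_ctx u s t v : insert_step E s t ->
  ent_chain E (u ++ s ++ v) ->
  hom (u ++ s ++ v) (u ++ t ++ v).
Proof.
move=> st cs; case: (st) => hs ht hst.
have [x _] : exists x, x \in s by case: (s) hs => [[/(_ erefl)]|x s' _] //;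
  exists x; rewrite mem_head.
have [h l] := insert_step_ends x st.
have ct : ent_chain E (u ++ t ++ v) by exact: (ent_chain_subst hs ht h l cs).
case: hst => [[u1 [y [v1 [u10 v10 es et]]]]|[y [es et]]].
  apply: rst_step; split=> //; left; exists (u ++ u1), y, (v1 ++ v).
  by rewrite es et -!catA; split=> //; [case: u {cs ct}|case: v1 v10 {es et}].
rewrite es et in cs ct *.
case: u cs ct => [|a u] cs ct.
  case: v cs ct => [|c v] cs ct; apply: rst_step; split=> //; [right|left].
    by exists y.
  by exists [:: y], y, (c :: v).
by apply: rst_step; split=> //; left; exists (a :: u), y, (y :: v).
Qed.

Lemma hom_ends x s t : hom s t -> head x s = head x t /\ last x s = last x t.
Proof.
elim=> [? ? /(insert_step_ends x)//|//|? ? _ [-> ->] //|? ? ? _ [-> ->] _ [->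
  ->] //].
Qed.

Lemma hom_chain s t : hom s t -> (ent_chain E s <-> ent_chain E t).
Proof.
elim=> [? ? [] //|//|? ? _ <- //|? ? ? _ -> _ -> //].
Qed.

(** The chain condition on the surrounding word is proved in the same induction, because the
    symmetric and transitive cases need it for the other chain and for the intermediate one. *)
Lemma hom_ctx u v s t : hom s t ->
  (ent_chain E (u ++ s ++ v) -> hom (u ++ s ++ v) (u ++ t ++ v)) /\
  (ent_chain E (u ++ s ++ v) <-> ent_chain E (u ++ t ++ v)).
Proof.
elim=> {s t} [s t st|s|s t _ [h1 h2]|s t w _ [h1 h2] _ [h3 h4]].
- split; first exact: insert_step_ctx.
  have [hs ht _] := st.
  have [x _] : exists x, x \in s by case: (s) hs => [[/(_ erefl)]|x s' _] //;
    exists x; rewrite mem_head.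
  have [h l] := insert_step_ends x st.
  by split; [exact: (ent_chain_subst hs ht h l)|exact: (ent_chain_subst ht hs
    (esym h) (esym l))].
- by split=> // _; apply: hom_refl.
- by split=> [/h2/h1/hom_sym|]; rewrite ?h2.
- by split=> [c|]; [apply: hom_trans (h1 c) (h3 _); apply/h2|rewrite h2].
Qed.

Lemma hom_catW u s t v : hom s t -> ent_chain E (u ++ s ++ v) ->
  hom (u ++ s ++ v) (u ++ t ++ v).
Proof. by move=> /(hom_ctx u v)[]. Qed.

Lemma hom_catl u s t : hom s t -> ent_chain E (u ++ s) -> hom (u ++ s) (u ++ t).
Proof. by move=> /(@hom_catW u _ _ [::]); rewrite !cats0. Qed.

Lemma hom_catr s t v : hom s t -> ent_chain E (s ++ v) -> hom (s ++ v) (t ++ v).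
Proof. exact: (@hom_catW [::]). Qed.

Lemma hom_del u x y z v : ent_chain E (u ++ [:: x, y, z & v]) -> ent_rel x z ->
  hom (u ++ [:: x, y, z & v]) (u ++ [:: x, z & v]).
Proof.
move=> c xz; apply/hom_sym/rst_step.
have c' : ent_chain E (u ++ [:: x, z & v]).
  by move: c; rewrite !ent_chain_cat /= xz => -[? /and3P[_ _ ->]].
split=> //; left; exists (rcons u x), y, (z :: v).
by rewrite !cat_rcons; split=> //; case: u {c c'}.
Qed.

Lemma hom_dup u x v : ent_chain E (u ++ x :: v) ->
  hom (u ++ [:: x, x & v]) (u ++ x :: v).
Proof.
move=> c; apply: hom_sym; apply: (@hom_catW u [:: x] [:: x; x] v) => //.
apply: rst_step; split; rewrite ?ent_chain_cons //=; last by right; exists x.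
by rewrite ent_rel_refl.
Qed.

Lemma hom_back x s : path ent_rel x s -> hom (rev (x :: s) ++ s) [:: last x s].
Proof.
elim: s x => [|y s IH] x; first by move=> _; apply: hom_refl.
move=> /= /andP[xy py]; rewrite rev_cons cat_rcons.
apply: hom_trans (IH _ py); rewrite rev_cons !cat_rcons.
have cr : ent_chain E (rev s ++ y :: s).
  rewrite ent_chain_cat; split=> //; rewrite -rev_cons; apply: ent_chain_rev.
  by apply/ent_chain_cons.
apply: hom_trans (hom_dup cr); apply: hom_del; last exact: ent_rel_refl.
move: cr; rewrite !ent_chain_cat /= => -[? ->]; split=> //.
by rewrite !(ent_rel_sym y x) xy.
Qed.

Lemma hom_forth x s : path ent_rel x s -> hom (x :: s ++ rev (belast x s)) [::
  x].
Proof.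
move=> p; have := @hom_back (last x s) (rev (belast x s)).
rewrite -rev_rcons -lastI revK => /(_ _).
have -> : last (last x s) (rev (belast x s)) = x.
  by case: s {p} => //= y s; rewrite rev_cons last_rcons.
apply; rewrite rev_path; apply: sub_path p => a c /=.
by rewrite ent_rel_sym.
Qed.

Lemma path_rev_belast x s : path ent_rel x s ->
  path ent_rel (last x s) (rev (belast x s)).
Proof.
move=> p; rewrite rev_path; apply: sub_path p => a c /=.
by rewrite ent_rel_sym.
Qed.

Lemma last_rev_belast x s : last (last x s) (rev (belast x s)) = x.
Proof. by case: s => //= y s; rewrite rev_cons last_rcons. Qed.

(** This reduces comparing two chains to the nullity of one loop, the form in which the finite
    invariant [net_null] can be applied. *)
Lemma hom_loopP x s t : path ent_rel x s -> path ent_rel x t ->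
  last x s = last x t ->
  hom (x :: s) (x :: t) <-> hom (x :: s ++ rev (belast x t)) [:: x].
Proof.
move=> ps pt st; split=> h.
  have c : ent_chain E ((x :: s) ++ rev (belast x t)).
    by rewrite ent_chain_cons cat_path ps st path_rev_belast.
  exact: hom_trans (hom_catr h c) (hom_forth pt).
have c : ent_chain E ((x :: s) ++ rev (belast x t) ++ t).
  rewrite /= ent_chain_cons !cat_path ps st path_rev_belast //=.
  by rewrite last_rev_belast.
have h1 : hom ((x :: s) ++ rev (belast x t) ++ t) (x :: t).
  by rewrite catA; apply: (@hom_catr _ [:: x]) => //; rewrite -catA.
apply: hom_trans h1; apply: hom_sym.
have := @hom_catl (belast x s) (rev (x :: t) ++ t) [:: last x s].
rewrite st cats1 -st -lastI lastI rev_rcons /= -st -cat_rcons -lastI.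
apply; last exact: c.
by have := hom_back pt; rewrite [in rev _]lastI rev_rcons st.
Qed.

(** The chain is coned off from its first point, one intermediate point being removed at a time.
    Chainedness enters the proof through this: a chain inside an [E]-ball about one of its ends is a
    single [E]-step. *)
Lemma hom_collapse x s : path ent_rel x s -> {in s, forall z, ent_rel x z} ->
  hom (x :: s) [:: x; last x s].
Proof.
elim: s => [|y s IH] /=.
  by move=> _ _; apply: hom_sym; apply: (@hom_dup [::] x [::]);
    apply/ent_chain_cons.
move=> /andP[xy py] h; case: s => [|z s] in IH py h *; first exact: hom_refl.
have xz : ent_rel x z by apply: h; rewrite !inE eqxx orbT.
have pz : path ent_rel x (z :: s) by move: py => /= /andP[_ ->]; rewrite xz.
apply: hom_trans (IH pz _); last by move=> w ws; apply: h; rewrite inE ws orbT.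
apply: (@hom_del [::]) => //; apply/ent_chain_cons => /=.
by rewrite xy.
Qed.

Lemma hom_triangle x y z : ent_rel x y -> ent_rel y z -> ent_rel x z ->
  hom [:: x; y; z] [:: x; z].
Proof.
move=> xy yz xz; apply: (@hom_del [::] x y z [::]) => //;
  apply/ent_chain_cons => /=.
by rewrite xy yz.
Qed.

End ChainHomotopy.

Lemma hom_sub (R : realType) (X : metricType R) (E E' : sym_entourage X) s t :
  ent_set E `<=` ent_set E' -> ent_homotopic E s t -> ent_homotopic E' s t.
Proof.
move=> EE'; have sub : subrel (ent_rel E) (ent_rel E').
  by move=> x y /ent_relP/EE'/ent_relP.
elim=> [{}s {}t [[s0 cs] [t0 ct] h]|?|? ? _|? ? ? _ + _]; last 3 first.
- exact: hom_refl.
- exact: hom_sym.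
- exact: hom_trans.
by apply: rst_step; split=> //; split=> //; apply: (sub_sorted sub).
Qed.

(** * Classes of chains *)

Section Classes.
Variables (R : realType) (X : metricType R) (E : sym_entourage X) (b : X).
Implicit Types (s t : seq X) (x y z : X) (q : ent_cover E b).

Local Notation hom := (ent_homotopic E).
Local Notation e := (ent_rel E).
Local Notation p := (@ent_proj R X E b).

Lemma based_nil_proof : `[< ent_chain E [:: b] /\ head b [:: b] = b >].
Proof. by apply/asboolP; split=> //; apply/ent_chain_cons. Qed.

Definition based_nil : based_chain E b := exist _ [:: b] based_nil_proof.

(* The class of [b :: s]; junk (the class of [:: b]) if it is not a chain.    *)
Definition cls s : ent_cover E b := \pi_(ent_cover E b)%qT (insubd based_nil (b
  :: s)).

Lemma val_based s : path e b s -> val (insubd based_nil (b :: s)) = b :: s.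
Proof.
move=> ps; rewrite val_insubd; case: asboolP => // -[].
by split=> //; apply/ent_chain_cons.
Qed.

Lemma cls_eqP s t : path e b s -> path e b t ->
  cls s = cls t <-> hom (b :: s) (b :: t).
Proof.
move=> ps pt; split=> [/eqmodP/asboolP|h]; first by rewrite !val_based.
by apply/eqmodP/asboolP; rewrite !val_based.
Qed.

Lemma based_cons (a : based_chain E b) :
  exists2 s, path e b s & val a = b :: s.
Proof.
case: a => [[|x s] /= h]; case/asboolP: (h) => -[s0 c] /= xb; first by [].
by rewrite xb in c *; exists s.
Qed.

Lemma cls_val (a : based_chain E b) s : val a = b :: s ->
  \pi_(ent_cover E b)%qT a = cls s.
Proof. by move=> h; rewrite /cls -h valKd. Qed.

Lemma cls_onto q : exists2 s, path e b s & q = cls s.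
Proof.
rewrite -(reprK q); have [s ps rs] := based_cons (repr q).
by exists s => //; apply: cls_val.
Qed.

Lemma proj_cls s : path e b s -> p (cls s) = last b s.
Proof. by move=> ps; rewrite ent_projE val_based. Qed.

(** The point over [y] on the sheet through [q], meaningful when [y] is [E]-close to the endpoint of
    [q]. All later arguments on the cover are computations with [ext], whose basic law [ext_ext] is
    the filling of an [E]-triangle. *)
Definition ext q y : ent_cover E b := cls (rcons (behead (val (repr q))) y).

Lemma ext_cls s y : path e b s -> e (last b s) y ->
  ext (cls s) y = cls (rcons s y).
Proof.
move=> ps sy; have [t pt rt] := based_cons (repr (cls s)).
have ct : cls s = cls t by rewrite -(cls_val rt) reprK.
have h : hom (b :: t) (b :: s) by apply/cls_eqP.
have ty : e (last b t) y by have [_ /= ->] := hom_ends b h.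
rewrite /ext rt /=; apply/cls_eqP; rewrite ?rcons_path ?ps ?pt //.
rewrite -!cats1 -!cat_cons; apply: hom_catr => //.
by rewrite cat_cons ent_chain_cons cat_path pt /= ty.
Qed.

Lemma proj_ext q y : e (p q) y -> p (ext q y) = y.
Proof.
have [s ps ->] := cls_onto q; rewrite proj_cls // => sy.
by rewrite ext_cls // proj_cls ?last_rcons // rcons_path ps.
Qed.

Lemma ext_id q : ext q (p q) = q.
Proof.
have [s ps ->] := cls_onto q; rewrite proj_cls // ext_cls ?ent_rel_refl //.
apply/cls_eqP; rewrite ?rcons_path ?ps ?ent_rel_refl //.
have := @hom_dup _ _ E (belast b s) (last b s) [::].
rewrite -!cat_rcons -lastI !cats0 /=.
by apply; apply/ent_chain_cons.
Qed.

Lemma ext_ext q y z : e (p q) y -> e y z -> e (p q) z ->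
  ext (ext q y) z = ext q z.
Proof.
have [s ps ->] := cls_onto q; rewrite proj_cls // => sy yz sz.
have psy : path e b (rcons s y) by rewrite rcons_path ps.
rewrite !ext_cls ?last_rcons //; apply/cls_eqP;
  rewrite ?rcons_path ?psy ?ps ?last_rcons ?sy //.
have := @hom_del _ _ E (belast b s) (last b s) y z [::].
rewrite -!cat_rcons -lastI !cats0 /=; apply => //.
by rewrite ent_chain_cons !rcons_path ps sy last_rcons.
Qed.

Lemma ext_back q y : e (p q) y -> ext (ext q y) (p q) = q.
Proof.
by move=> qy; rewrite ext_ext ?ext_id ?ent_rel_refl // ent_rel_sym.
Qed.

(** Forward, put alpha in front of the given homotopy: alpha followed by its reversal cancels, so
    beta is homotopic to alpha with the endpoint of beta appended. *)
Lemma ent_starP (F : sym_entourage X) q q' : ent_set F `<=` ent_set E ->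
  ent_star F (q, q') <-> ent_set F (p q, p q') /\ q' = ext q (p q').
Proof.
move=> FE; split.
  case=> a [a' /= []]; have [s ps sa] := based_cons a;
    have [t pt ta] := based_cons a'.
  rewrite sa ta (cls_val sa) (cls_val ta) /= => <- <-;
    rewrite !proj_cls // => st h.
  split=> //; have est : e (last b s) (last b t) by apply/ent_relP/FE.
  rewrite ext_cls //; apply/cls_eqP; rewrite ?rcons_path ?ps //.
  have pb : path e (last b s) (rev (belast b s) ++ t).
    by rewrite cat_path path_rev_belast // last_rev_belast pt.
  have c : ent_chain E ((b :: s) ++ rev (belast b s) ++ t).
    by rewrite cat_cons ent_chain_cons cat_path ps.
  apply: (@hom_trans _ _ _ ((b :: s) ++ rev (belast b s) ++ t)).
    by apply: hom_sym; rewrite catA; apply: (@hom_catr _ _ _ _ [:: b]);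
      [exact: hom_forth|rewrite -catA].
  have -> : b :: rcons s (last b t) = belast b s ++ [:: last b s; last b t].
    by rewrite -cat_rcons -lastI cats1.
  rewrite [b :: s]lastI in h c *; rewrite rev_rcons in h.
  rewrite cat_rcons in c *.
  exact: hom_catl.
case=> Fq eq'; have [s ps qs] := cls_onto q.
have est : e (last b s) (p q') by apply/ent_relP/FE; rewrite -(proj_cls ps) -qs.
exists (insubd based_nil (b :: s)), (insubd based_nil (b :: rcons s (p q'))).
have psq : path e b (rcons s (p q')) by rewrite rcons_path ps.
rewrite !val_based //=; split=> //.
- by rewrite [RHS]eq' qs ext_cls.
- by rewrite last_rcons -(proj_cls ps) -qs.
rewrite last_rcons -cats1 catA.
apply: (@hom_catr _ _ _ _ [:: last b s]); first exact: hom_back.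
by rewrite lastI rev_rcons /= ent_chain_cons !cat_path path_rev_belast //
  last_cat last_rev_belast ps /= est.
Qed.

End Classes.

(** * Topological preliminaries *)

Section Topology.
Variable R : realType.

(** A Lebesgue number argument for binary relations; it yields both uniform continuity and
    [unit_loc_const]. *)
Lemma lebesgue_rel (M : pseudoMetricType R) (K : set M) (P : M -> M -> Prop) :
  compact K ->
  (forall x, K x -> exists2 r, 0 < r & forall y z, K y -> K z ->
     ball x r y -> ball x r z -> P y z) ->
  exists2 r, 0 < r & forall y z, K y -> K z -> ball y r z -> P y z.
Proof.
move=> /compact_near_coveringP cK h.
pose Q (i : R) x := K x -> forall z, K z -> ball x i z -> P x z.
have hQ : \forall i \near (0 : R)^'+, K `<=` Q i.
  apply: cK => x /h[r r0 hr].
  exists (ball x (r / 2), [set i | i < r / 2]) => /=.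
    split; first by apply: nbhsx_ballx; rewrite divr_gt0.
    by apply: nbhs_right_lt; rewrite divr_gt0.
  move=> [y i] /= [xy ir] Ky z Kz yz; apply: hr => //.
    by apply: le_ball xy; lra.
  rewrite [r]splitr; apply: ball_triangle xy _.
  by apply: le_ball yz; apply: ltW.
have /filter_ex[r [r0 hr]] : \forall i \near (0 : R)^'+, 0 < i /\ K `<=` Q i.
  by near=> i; split; near: i => //; exact: nbhs_right_gt.
by exists r => // y z Ky Kz; apply: hr.
Unshelve. all: by end_near. Qed.

Lemma within_continuousP (T U : topologicalType) (A : set T) (f : T -> U) :
  {within A, continuous f} <->
  forall x, A x -> forall V, nbhs (f x) V -> \forall y \near x, A y -> V (f y).
Proof. by rewrite subspace_continuousP. Qed.

Lemma within_comp (T U V : topologicalType) (A : set T) (B : set U)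
    (f : T -> U) (g : U -> V) :
  {within A, continuous f} -> {within B, continuous g} ->
  (forall x, A x -> B (f x)) -> {within A, continuous (g \o f)}.
Proof.
move=> /within_continuousP cf /within_continuousP cg AB.
apply/within_continuousP => x Ax W /= /(cg _ (AB _ Ax)) /(cf _ Ax).
by apply: filterS => y h Ay; apply: h => //; apply: AB.
Qed.

Lemma within_eq (T U : topologicalType) (A : set T) (f g : T -> U) :
  (forall x, A x -> f x = g x) ->
  {within A, continuous f} -> {within A, continuous g}.
Proof.
by move=> fg; apply: subspace_eq_continuous => x; rewrite inE; apply: fg.
Qed.

Lemma within_if (T U : topologicalType) (A : set T) (u : T -> R) (c : R)
    (f g : T -> U) :
  closed A -> continuous u ->
  {within A `&` [set x | u x <= c], continuous f} ->
  {within A `&` [set x | c <= u x], continuous g} ->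
  (forall x, A x -> u x = c -> f x = g x) ->
  {within A, continuous (fun x => if u x <= c then f x else g x)}.
Proof.
move=> cA cu cf cg fg.
have -> : A = (A `&` [set x | u x <= c]) `|` (A `&` [set x | c <= u x]).
  rewrite -setIUr; apply/seteqP; split=> x //=; last by case.
  by move=> Ax; split=> //; have [|/ltW] := leP (u x) c; [left|right].
apply: withinU_continuous.
- by apply: closedI => //; apply: (preimage_closed (fun x _ =>
    cu x) (@closed_le _ c)).
- by apply: closedI => //; apply: (preimage_closed (fun x _ =>
    cu x) (@closed_ge _ c)).
- by apply: within_eq cf => x /= [_ ->].
- apply: within_eq cg => x /= [Ax]; rewrite le_eqVlt => /orP[/eqP xc|xc].
    by rewrite -xc lexx fg.
  by rewrite leNgt xc.
Qed.

Lemma unif_archi (r : R) : 0 < r -> exists2 n, (0 < n)%N & n%:R^-1 < r.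
Proof.
move=> r0; exists (Num.truncn r^-1).+1 => //.
by rewrite invf_plt ?posrE ?ltr0Sn //; apply: truncnS_gt.
Qed.

(** Connectedness of the unit interval, for maps into a bare type. With [T] := [Prop] it propagates
    a property along a path; with values in a cover it compares endpoints of lifts. *)
Lemma unit_loc_const (T : Type) (Z : R -> T) :
  (forall t, 0 <= t <= 1 -> exists2 r, 0 < r & forall s, 0 <= s <= 1 ->
     `|s - t| < r -> Z s = Z t) -> Z 0 = Z 1.
Proof.
move=> h; have [|r r0 hr] := @lebesgue_rel R^o `[0, 1] (fun s t =>
  Z s = Z t) (@segment_compact R 0 1).
  move=> t; rewrite /= in_itv /= => /h[r r0 hr]; exists r => // y z;
    rewrite /= !in_itv /=.
  by move=> y01 z01; rewrite /ball /= distrC => ty; rewrite distrC => tz;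
    rewrite !hr.
have [n n0 nr] := unif_archi r0.
have n0' : 0 < n%:R :> R by rewrite ltr0n.
have Zk k : (k <= n)%N -> Z 0 = Z (k%:R / n%:R).
  elim: k => [|k IH] kn; first by rewrite mul0r.
  rewrite (IH (ltnW kn)); apply: hr; rewrite /= ?in_itv /= ?divr_ge0 ?ler0n //=.
  - by rewrite ler_pdivrMr // mul1r ler_nat ltnW.
  - by rewrite ler_pdivrMr // mul1r ler_nat.
  rewrite /ball /= -mulrBl -natr1 opprD addNKr normrM normrN1 mul1r.
  by rewrite gtr0_norm ?invr_gt0.
by rewrite (Zk n) // divff // gt_eqF.
Qed.

End Topology.

(** * Path lifting *)

Section Metric.
Variables (R : realType) (X : metricType R).

Lemma nbhs_distP (x : X) (A : set X) :
  nbhs x A <-> exists2 r, 0 < r & forall y, mdist x y < r -> A y.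
Proof.
have H := @metricType_numDomainType.nbhs_mdistP R X x A.
by split=> [/(iffLR H)[r r0 h]|[r r0 h]]; [|apply/(iffRL H)]; exists r => // y;
  apply: h.
Qed.

Lemma eps_entourage_entourage (r : R) : 0 < r ->
  entourage (@eps_entourage R X r).
Proof.
move=> r0; rewrite -entourage_from_ballE; exists r => // -[x y] /=.
by rewrite ballEmdist.
Qed.

Lemma eps_entourage_sym (r : R) (x y : X) :
  eps_entourage r (x, y) -> eps_entourage r (y, x).
Proof. by rewrite /eps_entourage /= metric_sym. Qed.

Definition eps_ent (r : R) (r0 : 0 < r) : sym_entourage X :=
  SymEntourage (@eps_entourage_sym r) (eps_entourage_entourage r0).

Lemma ent_eps (E : sym_entourage X) :
  exists2 r : R, 0 < r & eps_entourage r `<=` ent_set E.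
Proof.
have := ent_entourage E; rewrite -entourage_from_ballE => -[r r0 h].
by exists r => // -[x y] xy; apply: h; rewrite /= ballEmdist.
Qed.

Lemma dist_within (T : topologicalType) (A : set T) (f : T -> X) :
  {within A, continuous f} <-> forall x, A x -> forall r, 0 < r ->
    \forall y \near x, A y -> mdist (f x) (f y) < r.
Proof.
rewrite within_continuousP; split=> h x Ax.
  by move=> r r0; apply: (h _ Ax [set z | mdist (f x) z < r]);
    apply/nbhs_distP; exists r.
by move=> V /nbhs_distP[r r0 hr]; apply: filterS (h _ Ax _ r0) =>
  y /[apply] /hr.
Qed.

Lemma unif_cont (M : pseudoMetricType R) (K : set M) (f : M -> X) (e : R) :
  compact K -> {within K, continuous f} -> 0 < e ->
  exists2 r, 0 < r & forall y z, K y -> K z -> ball y r z ->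
    mdist (f y) (f z) < e.
Proof.
move=> cK /dist_within cf e0; apply: lebesgue_rel => // x Kx.
have /cf/(_ (e / 2)) := Kx; rewrite divr_gt0 // =>
  /(_ isT) /nbhs_ballP[r /= r0 hr].
exists r => // y z Ky Kz xy xz; apply: le_lt_trans (metric_triangle _ (f x) _)
  _.
by rewrite [e]splitr metric_sym ltrD //; apply: hr.
Qed.

Lemma unit_near (P : R -> Prop) (t : R) :
  (exists2 r, 0 < r & forall s, 0 <= s <= 1 -> `|s - t| < r -> P s) <->
  (\forall s \near t, `[0, 1]%classic s -> P s).
Proof.
split=> [[r r0 h]|/nbhs_ballP[r /= r0 h]].
  apply/nbhs_ballP; exists r => // s; rewrite /ball /= in_itv /= distrC =>
    ts s01.
  exact: h.
by exists r => // s s01 st; apply: h; rewrite /= ?in_itv // /ball /= distrC.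
Qed.

End Metric.

(** * Sampling of paths *)

Section Fine.
Variables (R : realType) (X : metricType R).
Implicit Types (c : R -> X) (g : R) (n k : nat).

(** The width 2 / n spans two consecutive cells of the subdivision, so that [lift_exists] can start
    from one sample point over both. *)
Definition fine_path g n c := (0 < n)%N /\ forall s t, 0 <= s <= 1 ->
  0 <= t <= 1 ->
  `|s - t| <= 2 / n%:R -> mdist (c s) (c t) < g.

Lemma fine_path_ex g c : 0 < g -> {within `[0, 1], continuous c} ->
  exists n, fine_path g n c.
Proof.
move=> g0 cc; have [r r0 hr] := unif_cont (@segment_compact R 0 1) cc g0.
have r20 : 0 < r / 2 by rewrite divr_gt0.
have [n n0 nr] := unif_archi r20.
exists n; split=> // s t s01 t01 st; apply: hr; rewrite /= ?in_itv //.
by rewrite /ball /=; apply: le_lt_trans st _; lra.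
Qed.

Lemma fine_pathW g g' n c : g <= g' -> fine_path g n c -> fine_path g' n c.
Proof. by move=> gg' [n0 h]; split=> // s t ? ? ?; apply: lt_le_trans gg';
  apply: h. Qed.

(* [c] is sampled at the times [i / n], [0 < i <= k]; the point [c 0] is left *)
(* out, as in [cls].                                                          *)
Definition disc n c k : seq X := mkseq (fun i => c (i.+1%:R / n%:R)) k.

Lemma disc_last n c k x : last x (disc n c k) = if k is 0%N then x else c (k%:R
  / n%:R).
Proof. by case: k => // k; rewrite /disc mkseqS last_rcons. Qed.

Lemma disc_lastE n c k : last (c 0) (disc n c k) = c (k%:R / n%:R).
Proof. by rewrite disc_last; case: k => //; rewrite mul0r. Qed.

Lemma frac01 n k : (k <= n)%N -> 0 <= (k%:R / n%:R : R) <= 1.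
Proof.
case: n => [|n] kn; first by rewrite invr0 mulr0 lexx ler01.
by rewrite divr_ge0 ?ler0n //= ler_pdivrMr ?ltr0Sn // mul1r ler_nat.
Qed.

Lemma fine_step g n c k : fine_path g n c -> (k < n)%N ->
  mdist (c (k%:R / n%:R)) (c (k.+1%:R / n%:R)) < g.
Proof.
move=> [n0 h] kn; apply: h; rewrite ?frac01 // 1?ltnW //.
rewrite -mulrBl -natr1 opprD addNKr mulN1r normrN gtr0_norm ?invr_gt0 ?ltr0n //.
by rewrite ler_pdivlMr ?ltr0n // mulVf ?pnatr_eq0 -?lt0n // ler1n.
Qed.

Lemma path_disc g n c k (E : sym_entourage X) : eps_entourage g `<=` ent_set E
  ->
  fine_path g n c -> (k <= n)%N -> path (ent_rel E) (c 0) (disc n c k).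
Proof.
move=> gE hc; elim: k => [//|k IH] kn.
rewrite /disc mkseqS rcons_path IH 1?ltnW //= -/(disc n c k) disc_lastE.
by apply/ent_relP/gE; apply: fine_step hc kn.
Qed.

End Fine.

(** * Topology of an entourage cover, and lifts of paths to it *)

Section CoverTopology.
Variables (R : realType) (X : metricType R) (E : sym_entourage X) (b : X).
Variables (g : R) (g0 : 0 < g) (gE : eps_entourage g `<=` ent_set E).
Implicit Types (x y z : X) (q : ent_cover E b).

Local Notation e := (ent_rel E).
Local Notation p := (@ent_proj R X E b).

Lemma eps_rel x y : mdist x y < g -> e x y.
Proof. by move=> xy; apply/ent_relP/gE. Qed.

Lemma near_cover q U : nbhs q U -> exists2 r, 0 < r & forall q',
  mdist (p q) (p q') < r -> q' = ext q (p q') -> U q'.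
Proof.
rewrite nbhsE => -[V [oV Vq] VU]; have [F [FE FV]] := oV _ Vq.
have [r r0 rF] := ent_eps F; exists r => // q' qq' eq'.
by apply/VU/FV; apply/ent_starP => //; split=> //; apply: rF.
Qed.

(** The sheet piece of radius [m] about [q] is open: around a point [q1] of it, what remains of the
    radius is an admissible entourage, and the triangle of projections has sides below [g], so
    [ext_ext] applies. *)
Lemma cover_near q (U : set (ent_cover E b)) r : 0 < r ->
  (forall q', mdist (p q) (p q') < r -> q' = ext q (p q') -> U q') -> nbhs q U.
Proof.
move=> r0 h; pose m := Num.min r g; have m0 : 0 < m by rewrite lt_min r0.
rewrite nbhsE; exists [set q' | mdist (p q) (p q') < m /\ q' = ext q (p q')];
  last first.
  by move=> q' /= [qq' eq']; apply: h => //; apply: lt_le_trans qq' _;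
    rewrite ge_min lexx.
split=> /=; last by rewrite mdistxx ext_id.
move=> q1 /= [qq1 eq1].
have d0 : 0 < m - mdist (p q) (p q1) by rewrite subr_gt0.
have sE : eps_entourage (m - mdist (p q) (p q1)) `<=` ent_set E.
  move=> -[x y] /= xy; apply: gE; apply: lt_le_trans xy _.
  rewrite lerBlDr (@le_trans _ _ g) ?ge_min ?lexx ?orbT //.
  by rewrite lerDl mdist_ge0.
exists (eps_ent X d0); split=> // q2 /= /ent_starP -/(_ sE) [/= q12 e2].
have q02 : mdist (p q) (p q2) < m.
  by apply: le_lt_trans (metric_triangle _ (p q1) _) _; rewrite addrC -ltrBrDr.
split=> //; rewrite [LHS]e2 [in LHS]eq1 ext_ext //; apply: eps_rel.
- by apply: lt_le_trans qq1 _; rewrite ge_min lexx orbT.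
- apply: lt_le_trans q12 _; rewrite lerBlDr (@le_trans _ _ g) ?ge_min ?lexx
    ?orbT //.
  by rewrite lerDl mdist_ge0.
- by apply: lt_le_trans q02 _; rewrite ge_min lexx orbT.
Qed.

Lemma proj_continuous : continuous p.
Proof.
move=> q V /= /nbhs_distP[r r0 h]; apply: (cover_near r0) => q' /= qq' _.
exact: h.
Qed.

Lemma lift_continuous (h : R -> ent_cover E b) :
  {within `[0, 1], continuous (p \o h)} ->
  (forall t, 0 <= t <= 1 -> exists2 r, 0 < r & forall s, 0 <= s <= 1 ->
    `|s - t| < r -> h s = ext (h t) (p (h s))) ->
  {within `[0, 1], continuous h}.
Proof.
move=> /dist_within cp hl; apply/within_continuousP =>
  t t01 U /near_cover[r r0 hr].
have /cp/(_ _ r0) h1 := t01.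
have /hl/unit_near h2 : 0 <= t <= 1 by move: t01; rewrite /= in_itv.
near=> s => s01; apply: hr.
  by move: s01; near: s.
by move: s01; near: s.
Unshelve. all: by end_near. Qed.

Lemma lift_local (h : R -> ent_cover E b) t r :
  {within `[0, 1], continuous h} -> 0 <= t <= 1 -> 0 < r ->
  exists2 r', 0 < r' & forall s, 0 <= s <= 1 -> `|s - t| < r' ->
    mdist (p (h t)) (p (h s)) < r /\ h s = ext (h t) (p (h s)).
Proof.
move=> /within_continuousP ch t01 r0; apply/unit_near.
apply: (ch _ _ [set q' | mdist (p (h t)) (p q') < r /\ q' = ext (h t) (p q')]).
  by rewrite /= in_itv.
by apply: (cover_near r0).
Qed.

(** Agreement of the two lifts is a locally constant proposition: near [t] each is [ext] of its
    value at [t], and [ext_back] recovers the value at [t] from a nearby one. *)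
Lemma lift_unique (h h' : R -> ent_cover E b) :
  {within `[0, 1], continuous h} -> {within `[0, 1], continuous h'} ->
  (forall t, 0 <= t <= 1 -> p (h t) = p (h' t)) -> h 0 = h' 0 -> h 1 = h' 1.
Proof.
move=> ch ch' hh' h0.
suff : (h 0 = h' 0) = (h 1 = h' 1) by rewrite h0 => <-.
apply: (@unit_loc_const R Prop (fun t => h t = h' t)) => t t01.
have [r r0 hr] := lift_local ch t01 g0.
have [r' r'0 hr'] := lift_local ch' t01 g0.
exists (Num.min r r'); first by rewrite lt_min r0.
move=> s s01; rewrite lt_min => /andP[sr sr'].
have [d1 e1] := hr _ s01 sr; have [d2 e2] := hr' _ s01 sr'.
apply/propext; split=> hs; last by rewrite e1 e2 hs -!hh' // hs.
have e3 (k : R -> ent_cover E b) : mdist (p (k t)) (p (k s)) < g ->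
    k s = ext (k t) (p (k s)) -> k t = ext (k s) (p (k t)).
  by move=> dk ek; rewrite [in RHS]ek ext_back //; apply: eps_rel.
by rewrite (e3 h) // (e3 h') // hs !hh'.
Qed.

(** On the cell numbered [K t] the lift is [ext] from the class [A (K t)] of the samples so far. It
    is continuous because [A k] serves equally well on the next cell ([hE]). *)
Lemma lift_exists (c : R -> X) n (s : seq X) : {within `[0, 1],
  continuous c} -> fine_path g n c ->
  path e b s -> last b s = c 0 ->
  exists h : R -> ent_cover E b, [/\ {within `[0, 1], continuous h},
    h 0 = cls E b s,
    forall t, 0 <= t <= 1 -> p (h t) = c t & h 1 = cls E b (s ++ disc n c n)].
Proof.
move=> cc hc ps sc; pose A k := cls E b (s ++ disc n c k).
have [n0 hn] := hc; have n0' : 0 < n%:R :> R by rewrite ltr0n.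
have pA k : (k <= n)%N -> path e b (s ++ disc n c k).
  by move=> kn; rewrite cat_path ps sc; apply: path_disc gE hc kn.
have projA k : (k <= n)%N -> p (A k) = c (k%:R / n%:R).
  by move=> kn; rewrite proj_cls ?pA // last_cat sc disc_lastE.
have AS k : (k < n)%N -> A k.+1 = ext (A k) (c (k.+1%:R / n%:R)).
  move=> kn; rewrite /A ext_cls; first by rewrite /disc mkseqS rcons_cat.
    exact/pA/ltnW.
  by rewrite last_cat sc disc_lastE; apply: eps_rel; apply: fine_step hc kn.
pose K (t : R) := Num.truncn (t * n%:R).
have Kt (t : R) : 0 <= t <= 1 -> [/\ (K t <= n)%N, (K t)%:R <= t * n%:R &
  t * n%:R < (K t).+1%:R].
  move=> /andP[t0 t1]; have /truncn_itv/andP[l u] : 0 <= t * n%:R by rewrite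
    mulr_ge0.
  split=> //; rewrite -(@ler_nat R); apply: le_trans l _.
  by rewrite -[leRHS]mul1r ler_pM2r.
pose h (t : R) := ext (A (K t)) (c t).
have close k (t : R) : 0 <= t <= 1 -> (k <= n)%N ->
  k%:R <= t * n%:R <= k.+2%:R ->
    mdist (c (k%:R / n%:R)) (c t) < g.
  move=> t01 kn /andP[l u]; apply: hn; rewrite ?frac01 // distrC.
  rewrite -(ler_pM2r n0') divfK ?gt_eqF // -[X in _ * X]gtr0_norm // -normrM
    mulrBl.
  rewrite divfK ?gt_eqF // ger0_norm ?subr_ge0 // lerBlDr (le_trans u) //.
  by rewrite -natrD.
have hE k (t : R) : 0 <= t <= 1 -> (k <= n)%N -> K t = k \/ K t = k.+1 ->
  h t = ext (A k) (c t).
  move=> t01 kn; have [Kn l u] := Kt _ t01; case=> Ek; first by rewrite /h Ek.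
  rewrite Ek in Kn l u; rewrite /h Ek AS //.
  rewrite ext_ext // ?projA //; apply: eps_rel.
  - exact: fine_step hc Kn.
  - by apply: close => //; rewrite l (le_trans (ltW u)) // ler_nat.
  - by apply: close => //; rewrite (ltW u) (le_trans _ l) // ler_nat.
have projh (t : R) : 0 <= t <= 1 -> p (h t) = c t.
  move=> t01; have [Kn l u] := Kt _ t01.
  rewrite /h proj_ext // projA //; apply: eps_rel; apply: close => //.
  by rewrite l (le_trans (ltW u)) // ler_nat.
exists h; split=> //.
- apply: lift_continuous.
    by apply: within_eq cc => t; rewrite /= in_itv /= => /projh.
  move=> t t01; exists n%:R^-1; first by rewrite invr_gt0.
  move=> u u01 tu; rewrite projh //.
  (* Times less than 1 / n apart lie in the same cell or in adjacent ones, so [A k] is a common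
     anchor for both. *)
  pose k := minn (K t) (K u).
  have [tn tl tu'] := Kt _ t01; have [un ul uu] := Kt _ u01.
  have : `|u * n%:R - t * n%:R| < 1.
    by rewrite -mulrBl normrM (gtr0_norm n0') -ltr_pdivlMr // mul1r.
  rewrite ltr_norml => /andP[d1 d2].
  have Ktu : (K t <= (K u).+1)%N.
    by rewrite -ltnS -(@ltr_nat R) -natr1; lra.
  have Kut : (K u <= (K t).+1)%N.
    by rewrite -ltnS -(@ltr_nat R) -natr1; lra.
  have kn : (k <= n)%N by rewrite geq_min tn.
  have kt : K t = k \/ K t = k.+1.
    rewrite /k /minn; case: ltnP => tu1; [by left|].
    by move: Ktu; rewrite leq_eqVlt => /orP[/eqP|]; [right|rewrite ltnS => ?;
      left; apply/eqP; rewrite eqn_leq; apply/andP].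
  have ku : K u = k \/ K u = k.+1.
    rewrite /k /minn; case: ltnP => tu1; [|by left].
    by right; apply/eqP; rewrite eqn_leq Kut.
  have cl (v : R) : 0 <= v <= 1 -> K v = k \/ K v = k.+1 ->
    mdist (c (k%:R / n%:R)) (c v) < g.
    move=> v01 kv; apply: close => //; have [_ vl vu] := Kt _ v01.
    by case: kv => kv; rewrite kv in vl vu; apply/andP; split;
      rewrite ?(le_trans _ vl) ?(le_trans (ltW vu)) // ler_nat.
  rewrite (hE k) // (hE k t) // ext_ext // ?projA //; apply: eps_rel;
    try exact: cl.
  apply: hn => //; rewrite distrC (le_trans (ltW tu)) // ler_pdivlMr // mulVf
    ?gt_eqF //.
  by rewrite ler1n.
- by rewrite /h /K mul0r truncn0 /A /= cats0 -sc -(proj_cls ps) ext_id.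
- rewrite /h /K mul1r natrK; have := ext_id (A n).
  by rewrite projA // divff ?gt_eqF.
Qed.

End CoverTopology.

(** * Geodesics and covering maps *)

Section Geodesics.
Variables (R : realType) (X : metricType R).
Hypothesis hgeo : geodesic X.

(** The length bounds the polygonal sum over the partition with the single inner point [t]. *)
Lemma geo_exists (x y : X) : exists2 f : R -> X, is_path x y f &
  forall t, 0 <= t <= 1 -> mdist x (f t) + mdist (f t) y <= mdist x y.
Proof.
have [f [cf f0 f1] lf] := hgeo x y; exists f => // t /andP[].
rewrite le_eqVlt => /orP[/eqP <- _|t0]; first by rewrite f0 mdistxx add0r.
rewrite le_eqVlt => /orP[/eqP ->|t1]; first by rewrite f1 mdistxx addr0.
rewrite -lee_fin -lf; apply: ereal_sup_ubound; exists [:: t; 1].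
  by rewrite /itv_partition /= t0 t1.
by rewrite /= big_nat_recl // big_nat1 /= f0 f1.
Qed.

Definition geo (x y : X) : R -> X := projT1 (cid2 (geo_exists x y)).

Lemma geo_path x y : is_path x y (geo x y).
Proof. by rewrite /geo; case: cid2. Qed.

Lemma geo_dist x y t : 0 <= t <= 1 ->
  mdist x (geo x y t) + mdist (geo x y t) y <= mdist x y.
Proof. by rewrite /geo; case: cid2 => /= f _ h /h. Qed.

Lemma geo_distl x y t : 0 <= t <= 1 -> mdist x (geo x y t) <= mdist x y.
Proof. by move=> /(geo_dist x y); apply: le_trans; rewrite lerDl mdist_ge0. Qed.

Lemma geo_distr x y t : 0 <= t <= 1 -> mdist y (geo x y t) <= mdist x y.
Proof.
by move=> /(geo_dist x y); apply: le_trans; rewrite metric_sym lerDr mdist_ge0.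
Qed.

Lemma geo_two_thirds (x y : X) : exists z, mdist x z <= 2 / 3 * mdist x y /\
  mdist z y <= mdist x y / 3.
Proof.
have [cg g0 g1] := geo_path x y.
have := @IVT R (fun t => mdist x (geo x y t)) 0 1 (2 / 3 * mdist x y) ler01.
case.
- apply/within_continuousP => t t01 V /= /nbhs_ballP[r /= r0 hr].
  move/dist_within/(_ _ t01 _ r0): cg; apply: filterS => s h s01; apply: hr.
  have {}h := h s01; rewrite /ball /=.
  have h1 := metric_triangle x (geo x y t) (geo x y s).
  have h2 := metric_triangle x (geo x y s) (geo x y t).
  rewrite (metric_sym (geo x y s)) in h2.
  by rewrite ltr_norml; lra.
- rewrite /= g0 g1 mdistxx; have := mdist_ge0 x y => d0.
  by rewrite min_l // max_r //; lra.
move=> t; rewrite in_itv /= => /(geo_dist x y) h1 h2; exists (geo x y t).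
by lra.
Qed.

Lemma geo_chain (F : sym_entourage X) (x y : X) : exists s,
  [/\ path (ent_rel F) x s, last x s = y &
      forall z, z \in x :: s -> exists2 t, 0 <= t <= 1 & z = geo x y t].
Proof.
have [cg g0 g1] := geo_path x y; have [r r0 rF] := ent_eps F.
have [n hn] := fine_path_ex r0 cg; exists (disc n (geo x y) n).
split.
- by rewrite -[X in path _ X]g0; apply: path_disc rF hn _.
- have := disc_lastE n (geo x y) n; rewrite g0 => ->.
  by rewrite divff // pnatr_eq0 -lt0n; case: hn.
move=> z; rewrite inE => /orP[/eqP ->|/mapP[i]].
  by exists 0; rewrite ?lexx ?ler01 ?g0.
rewrite mem_iota add0n => /andP[_ iln] ->.
by exists (i.+1%:R / n%:R) => //; apply: frac01.
Qed.

(** The set is open, and samples of a geodesic from [x] to [y] are no farther from either end than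
    [x] is from [y]. *)
Lemma eps_ent_chained (r : R) (r0 : 0 < r) : chained (eps_ent X r0).
Proof.
split.
  apply: (@subset_trans _ (interior (eps_entourage r)));
    last exact: subset_closure.
  move=> [x y] /= xy; have d0 : 0 < (r - mdist x y) / 2 by rewrite divr_gt0 //
    subr_gt0.
  exists ([set z | mdist x z < (r - mdist x y) / 2],
    [set z | mdist y z < (r - mdist x y) / 2]).
    by split; apply/nbhs_distP; exists ((r - mdist x y) / 2).
  move=> [z w] /= [xz yw]; rewrite /eps_entourage /=.
  have h1 := metric_triangle z x w; have h2 := metric_triangle x y w.
  by rewrite (metric_sym z x) in h1; lra.
move=> x y F xy; have [s [ps sy hs]] := geo_chain F x y.
exists s; split=> //.
move=> z /hs[t t01 ->]; rewrite /ent_ball /= /eps_entourage /=; split.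
  by apply: le_lt_trans (geo_distl _ _ t01) xy.
by apply: le_lt_trans (geo_distr _ _ t01) xy.
Qed.

End Geodesics.

(** * Entourage covers as covering maps, and their connectedness *)

Section Covering.
Variables (R : realType) (X : metricType R) (E : sym_entourage X) (b : X).
Hypothesis hgeo : geodesic X.

Local Notation e := (ent_rel E).
Local Notation p := (@ent_proj R X E b).

Lemma ent_proj_surj x : exists q, p q = x.
Proof.
have [s [ps <- _]] := geo_chain hgeo E b x.
by exists (cls E b s); rewrite proj_cls.
Qed.

Lemma ent_proj_covering : covering_map p.
Proof.
have [g g0 gE] := ent_eps E.
have g2 : 0 < g / 2 by rewrite divr_gt0.
have rel x y z : mdist x y < g / 2 -> mdist x z < g / 2 -> e y z.
  move=> xy xz; apply: (eps_rel gE); apply: le_lt_trans (metric_triangle _ x _)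
    _.
  by rewrite (metric_sym y) [g]splitr ltrD.
have relx x y : mdist x y < g / 2 -> e x y by apply: rel; rewrite mdistxx.
split.
- exact: proj_continuous g0 gE.
- by apply/seteqP; split=> // x _; have [q <-] := ent_proj_surj x; exists q.
move=> x; exists [set y | mdist x y < g / 2]; split=> /=; last 2 first.
- by rewrite mdistxx.
(* The sheets over the ball of radius g / 2, indexed by the fibre over [x]. Any two points of this
   ball are [E]-close, and the sheet through [q'] is the one of [ext q' x]. *)
- pose V q := [set q' | mdist x (p q') < g / 2 /\ q' = ext q (p q')].
  have Vx q q' : p q = x -> V q q' -> ext q' x = q.
    by move=> qx [xq' ->]; rewrite -qx ext_back // qx relx.
  exists (V @` [set q | p q = x]); split.
  + apply/seteqP; split=> q' /=; last by case=> _ [q _ <-] [].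
    move=> xq'; have rq : e (p q') x by rewrite ent_rel_sym relx.
    exists (V (ext q' x)); first by exists (ext q' x) => //; exact: proj_ext.
    split=> //; rewrite ext_ext ?ext_id ?ent_rel_refl //.
    by rewrite ent_rel_sym.
  + move=> _ _ [q qx <-] [q1 q1x <-] [q' /= [h h1]].
    by rewrite -(Vx _ _ qx h) -(Vx _ _ q1x h1).
  move=> _ [q /= qx <-].
  have Vext y : mdist x y < g / 2 -> V q (ext q y).
    by move=> xy; rewrite /V /= proj_ext ?qx ?relx.
  split.
  + rewrite openE => q' [/= xq' eq']; rewrite /interior.
    have d0 : 0 < g / 2 - mdist x (p q') by rewrite subr_gt0.
    apply: (cover_near g0 gE d0) => q2 d2 e2.
    have xq2 : mdist x (p q2) < g / 2.
      by apply: le_lt_trans (metric_triangle _ (p q') _) _;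
        rewrite addrC -ltrBrDr.
    by split=> //; rewrite [LHS]e2 [in LHS]eq' ext_ext ?qx //;
      [exact: relx|exact: (rel x)|exact: relx].
  + split.
    * by move=> q' [].
    * by move=> q' q2; rewrite !inE => -[_ e1] [_ e2] h; rewrite e1 e2 h.
    * by move=> y /= xy; exists (ext q y);
        [exact: Vext|rewrite proj_ext // qx relx].
  move=> W oW WV; rewrite openE => _ [w Ww <-]; rewrite /interior.
  have /near_cover[r r0 hr] : nbhs w W by apply: open_nbhs_nbhs.
  have m0 : 0 < Num.min r g by rewrite lt_min r0.
  apply/nbhs_distP; exists (Num.min r g) => // y.
  rewrite lt_min => /andP[wr wg]; have we := eps_rel gE wg.
  by exists (ext w y); [apply: hr; rewrite proj_ext|rewrite proj_ext].
- rewrite openE => y /= xy; rewrite /interior; apply/nbhs_distP.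
  exists (g / 2 - mdist x y); first by rewrite subr_gt0.
  move=> z yz; apply: le_lt_trans (metric_triangle _ y _) _.
  by rewrite addrC -ltrBrDr.
Qed.

Lemma clopen_path (T : topologicalType) (B : set T) (h : R -> T) :
  open B -> closed B -> {within `[0, 1], continuous h} -> B (h 0) = B (h 1).
Proof.
move=> oB cB /within_continuousP ch.
apply: (@unit_loc_const R Prop (fun t => B (h t))) => t t01.
have [Bt|nBt] := pselect (B (h t)); apply/unit_near.
  have : nbhs (h t) B by apply: open_nbhs_nbhs.
  move=> /(ch t); rewrite /= in_itv /= => /(_ t01).
  by apply: filterS => s /[apply] Bs; apply/propext; split.
have : nbhs (h t) (~` B) by apply: open_nbhs_nbhs; split=> //;
  apply: closed_openC.
move=> /(ch t); rewrite /= in_itv /= => /(_ t01).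
by apply: filterS => s /[apply] Bs; apply/propext; split.
Qed.

Lemma ext_path q y : (forall t, 0 <= t <= 1 -> e (p q) (geo hgeo (p q) y t)) ->
  exists h : R -> ent_cover E b, is_path q (ext q y) h.
Proof.
move=> he; have [cg c0 c1] := geo_path hgeo (p q) y.
have [g g0 gE] := ent_eps E.
exists (fun t => ext q (geo hgeo (p q) y t)); split; rewrite ?c0 ?c1 ?ext_id //.
have ph t : 0 <= t <= 1 -> p (ext q (geo hgeo (p q) y t)) = geo hgeo (p q) y t.
  by move=> t01; rewrite proj_ext // he.
apply: lift_continuous.
  by apply: within_eq cg => t; rewrite /= in_itv /= => /ph.
move=> t t01; have /unit_near[r r0 hr] : \forall s \near t, `[0, 1]%classic s ->
    mdist (geo hgeo (p q) y t) (geo hgeo (p q) y s) < g.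
  by move: cg => /dist_within; apply=> //; rewrite /= in_itv.
by exists r => // s s01 /hr hs; rewrite ph // ext_ext ?he // (eps_rel gE) // hs.
Qed.

End Covering.

(** Any class is reached from the trivial one step at a time, and each step is a path in the cover:
    the lift of a geodesic, which stays within distance r of its origin. A clopen set cannot be left
    along such paths. *)
Lemma eps_cover_connected (R : realType) (X : metricType R) (b : X) (r : R)
  (r0 : 0 < r) : geodesic X -> connected [set: ent_cover (eps_ent X r0) b].
Proof.
move=> hgeo B [q Bq] [C oC BC] [D cD BD].
rewrite setTI in BC; rewrite setTI in BD.
have oB : open B by rewrite BC.
have cB : closed B by rewrite BD.
suff Bcls s : path (ent_rel (eps_ent X r0)) b s ->
  B (cls _ b [::]) = B (cls _ b s).
  apply/seteqP; split=> // q' _.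
  have [s ps qs] := cls_onto q; have [t pt ->] := cls_onto q'.
  by rewrite -Bcls // (Bcls s) // -qs.
elim/last_ind: s => [//|s y IH]; rewrite rcons_path => /andP[ps sy].
rewrite IH // -ext_cls //.
have [|h [ch h0 h1]] := @ext_path _ _ (eps_ent X r0) b hgeo (cls _ b s) y.
  move=> t t01; rewrite proj_cls //; apply/ent_relP;
    rewrite /= /eps_entourage /=.
  by apply: le_lt_trans (geo_distl hgeo _ _ t01) _; move/ent_relP: sy.
by have := clopen_path oB cB ch; rewrite h0 h1.
Qed.

(** * Homotopies of paths *)

Section Continuity.
Variable R : realType.

Lemma fst_continuous (T U : topologicalType) : continuous (@fst T U).
Proof. by move=> [x y]; exact: cvg_fst. Qed.

Lemma snd_continuous (T U : topologicalType) : continuous (@snd T U).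
Proof. by move=> [x y]; exact: cvg_snd. Qed.

Lemma pair_continuous (T U V : topologicalType) (u : T -> U) (v : T -> V) :
  continuous u -> continuous v -> continuous (fun x => (u x, v x)).
Proof. by move=> cu cv x; apply: cvg_pair; [exact: cu|exact: cv]. Qed.

Lemma closed_prod (T U : topologicalType) (A : set T) (B : set U) :
  closed A -> closed B -> closed (A `*` B).
Proof.
move=> cA cB; have -> : A `*` B = fst @^-1` A `&` snd @^-1` B by [].
by apply: closedI; apply: preimage_closed => // x _;
  [exact: fst_continuous|exact: snd_continuous].
Qed.

Lemma affine_continuous (a c : R) : continuous (fun t : R => a * t + c).
Proof.
by move=> t; apply: cvgD; [apply: cvgM; [exact: cvg_cst|exact: cvg_id]|exact:
  cvg_cst].
Qed.

Lemma affine_comp_continuous (T : topologicalType) (u : T -> R) (a c : R) :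
  continuous u -> continuous (fun x => a * u x + c).
Proof.
move=> cu x; apply: (@continuous_comp _ _ _ u (fun t => a * t + c));
  first exact: cu.
exact: affine_continuous.
Qed.

Lemma max_continuous (u v : R -> R) : continuous u -> continuous v ->
  continuous (fun t => Num.max (u t) (v t)).
Proof. by move=> cu cv t; apply: (@continuous_max _ _ u v t);
  [exact: cu|exact: cv]. Qed.

End Continuity.

Section PathHomotopy.
Variables (R : realType) (T : topologicalType).
Implicit Types (f g h k : R -> T) (x y z w : T).

Local Notation I := (`[0, 1]%classic : set R).

Lemma is_path_eq x y f g : (forall t, 0 <= t <= 1 -> f t = g t) ->
  is_path x y f -> is_path x y g.
Proof.
move=> fg [cf f0 f1]; split; rewrite -?fg ?lexx ?ler01 //.
by apply: within_eq cf => t; rewrite /= in_itv /=; apply: fg.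
Qed.

Lemma is_path_cst x : is_path x x (cst x : R -> T).
Proof. by split=> //; apply: continuous_subspaceT; exact: cst_continuous. Qed.

Lemma is_path_comp x y f (phi : R -> R) : is_path x y f -> continuous phi ->
  (forall t, 0 <= t <= 1 -> 0 <= phi t <= 1) ->
  is_path (f (phi 0)) (f (phi 1)) (f \o phi).
Proof.
move=> [cf _ _] cphi h; split=> //.
apply: within_comp cf _; first exact: continuous_subspaceT.
by move=> t; rewrite /= !in_itv /=; apply: h.
Qed.

Lemma is_path_rev x y f : is_path x y f -> is_path y x (path_rev f).
Proof.
move=> pf; have [_ f0 f1] := pf.
have := @is_path_comp x y f (fun t => -1 * t + 1) pf (@affine_continuous R (-1)
  1).
rewrite mulr0 add0r mulr1 addNr f0 f1 => H.
apply: is_path_eq (H _) => [t _|t t01]; last by lra.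
by rewrite /path_rev /=; congr f; lra.
Qed.

Lemma is_path_cat x y z f g : is_path x y f -> is_path y z g ->
  is_path x z (path_cat f g).
Proof.
move=> [cf f0 f1] [cg g0' g1]; split; rewrite /path_cat; last 2 first.
- by rewrite mulr0 invr_ge0 ler0n.
- by rewrite ifF; [rewrite mulr1 -g1; congr g; lra|apply/negbTE;
    rewrite -ltNge; lra].
apply: (@within_if R R T I id 2^-1 (fun t => f (2 * t)) (fun t =>
  g (2 * t - 1))).
- exact: itv_closed.
- by move=> t; apply: cvg_id.
- apply: (within_comp _ cf); first by apply: continuous_subspaceT => t;
    apply: cvgM; [exact: cvg_cst|exact: cvg_id].
  by move=> t; rewrite /= !in_itv /=; lra.
- apply: (within_comp _ cg); first exact/continuous_subspaceT/affine_continuous.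
  by move=> t; rewrite /= !in_itv /=; lra.
- by move=> t _ ->; rewrite divff // f1 subrr g0'.
Qed.

Definition hpath x y f g :=
  [/\ is_path x y f, is_path x y g & path_homotopic x y f g].

Lemma hpath_eq x y f g : (forall t, 0 <= t <= 1 -> f t = g t) ->
  is_path x y f -> hpath x y f g.
Proof.
move=> fg pf; have [cf f0 f1] := pf; split=> //; first exact: is_path_eq pf.
exists (f \o snd); split=> /=; last 2 first.
- by move=> t /fg ->.
- by [].
apply: (within_comp _ cf); last by move=> [s t] /= [].
exact/continuous_subspaceT/snd_continuous.
Qed.

Lemma hpath_refl x y f : is_path x y f -> hpath x y f f.
Proof. exact: hpath_eq. Qed.

Lemma hpath_sym x y f g : hpath x y f g -> hpath x y g f.
Proof.
move=> [pf pg [H [cH Hfg Hxy]]]; split=> //.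
exists (fun st => H (-1 * st.1 + 1, st.2)); split=> /=.
- apply: (within_comp _ cH); last by move=> [s t] /= []; rewrite !in_itv /=;
    lra.
  apply/continuous_subspaceT/pair_continuous/snd_continuous.
  exact/affine_comp_continuous/fst_continuous.
- by move=> t /Hfg[h0 h1]; rewrite mulr0 add0r mulr1 addNr.
- by move=> s s01; apply: Hxy; lra.
Qed.

Lemma hpath_trans g x y f h : hpath x y f g -> hpath x y g h -> hpath x y f h.
Proof.
move=> [pf pg [H [cH Hfg Hxy]]] [_ ph [K [cK Kgh Kxy]]]; split=> //.
exists (fun st => if st.1 <= 2^-1 then H (2 * st.1 + 0,
  st.2) else K (2 * st.1 - 1, st.2)).
split=> /=; last 2 first.
- move=> t t01; rewrite mulr0 addr0 invr_ge0 ler0n; have [-> _] := Hfg _ t01;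
    split=> //.
  rewrite ifF; last by apply/negbTE; rewrite -ltNge; lra.
  by have [_ <-] := Kgh _ t01; congr (K (_, _)); lra.
- by move=> s s01; case: ifPn; rewrite -?ltNge => hs; [apply: Hxy|apply: Kxy];
    lra.
apply: (@within_if R (R * R)%type T (I `*` I) fst 2^-1
  (fun st => H (2 * st.1 + 0, st.2)) (fun st => K (2 * st.1 - 1, st.2))).
- by apply: closed_prod; apply: itv_closed.
- exact: fst_continuous.
- apply: (within_comp _ cH); last by move=> [s t] /= [[]]; rewrite !in_itv /=;
    lra.
  apply/continuous_subspaceT/pair_continuous/snd_continuous.
  exact/affine_comp_continuous/fst_continuous.
- apply: (within_comp _ cK); last by move=> [s t] /= [[]]; rewrite !in_itv /=;
    lra.
  apply/continuous_subspaceT/pair_continuous/snd_continuous.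
  exact/affine_comp_continuous/fst_continuous.
move=> [s t] /= [_]; rewrite in_itv /= => t01 ->; rewrite divff // addr0 subrr.
by have [_ ->] := Hfg _ t01; have [-> _] := Kgh _ t01.
Qed.

Lemma hpath_cat x y z f f' g g' : hpath x y f f' -> hpath y z g g' ->
  hpath x z (path_cat f g) (path_cat f' g').
Proof.
move=> [pf pf' [H [cH Hf Hxy]]] [pg pg' [K [cK Kg Kyz]]].
split; [exact: is_path_cat pf pg|exact: is_path_cat pf' pg'|].
exists (fun st => if st.2 <= 2^-1 then H (st.1, 2 * st.2 + 0) else K (st.1,
  2 * st.2 - 1)).
split=> /=; last 2 first.
- move=> t t01; rewrite /path_cat; case: ifPn; rewrite -?ltNge => ht.
    by rewrite addr0; apply: Hf; lra.
  by apply: Kg; lra.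
- move=> s s01; rewrite mulr0 addr0 invr_ge0 ler0n; have [-> _] := Hxy _ s01;
    split=> //.
  rewrite ifF; last by apply/negbTE; rewrite -ltNge; lra.
  by have [_ <-] := Kyz _ s01; congr (K (_, _)); lra.
apply: (@within_if R (R * R)%type T (I `*` I) snd 2^-1
  (fun st => H (st.1, 2 * st.2 + 0)) (fun st => K (st.1, 2 * st.2 - 1))).
- by apply: closed_prod; apply: itv_closed.
- exact: snd_continuous.
- apply: (within_comp _ cH); last by move=> [s t] /= [[]]; rewrite !in_itv /=;
    lra.
  apply/continuous_subspaceT/pair_continuous; first exact: fst_continuous.
  exact/affine_comp_continuous/snd_continuous.
- apply: (within_comp _ cK); last by move=> [s t] /= [[]]; rewrite !in_itv /=;
    lra.
  apply/continuous_subspaceT/pair_continuous; first exact: fst_continuous.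
  exact/affine_comp_continuous/snd_continuous.
move=> [s t] /= [+ _] ->; rewrite in_itv /= => s01;
  rewrite divff // addr0 subrr.
by have [_ ->] := Hxy _ s01; have [-> _] := Kyz _ s01.
Qed.

(* The straight-line homotopy between [phi] and [psi], composed with [F].     *)
Lemma hpath_reparam x y x' y' F f g (phi psi : R -> R) : is_path x' y' F ->
  continuous phi -> continuous psi ->
  (forall t, 0 <= t <= 1 -> 0 <= phi t <= 1 /\ f t = F (phi t)) ->
  (forall t, 0 <= t <= 1 -> 0 <= psi t <= 1 /\ g t = F (psi t)) ->
  phi 0 = psi 0 -> phi 1 = psi 1 -> f 0 = x -> f 1 = y ->
  hpath x y f g.
Proof.
move=> pF cphi cpsi hphi hpsi e0 e1 f0 f1.
have l01 : 0 <= (0 : R) <= 1 by rewrite lexx ler01.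
have r01 : 0 <= (1 : R) <= 1 by rewrite lexx ler01.
have [_ F0] := hphi _ l01; have [_ F1] := hphi _ r01.
have pf : is_path x y f.
  rewrite -f0 -f1 F0 F1; apply: is_path_eq (is_path_comp pF cphi _).
    by move=> t /hphi[].
  by move=> t /hphi[].
have pg : is_path x y g.
  rewrite -f0 -f1 F0 F1 e0 e1; apply: is_path_eq (is_path_comp pF cpsi _).
    by move=> t /hpsi[].
  by move=> t /hpsi[].
split=> //; have [cF _ _] := pF.
exists (fun st => F ((1 - st.1) * phi st.2 + st.1 * psi st.2)); split=> /=;
  last 2 first.
- move=> t t01; rewrite subr0 subrr !mul1r !mul0r addr0 add0r.
  by have [_ ->] := hphi _ t01; have [_ ->] := hpsi _ t01.
- move=> s s01; rewrite -e0 -e1 -!mulrDl subrK !mul1r.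
  by rewrite -F0 -F1.
apply: (within_comp _ cF).
  apply: continuous_subspaceT => -[s t]; apply: cvgD.
    apply: cvgM; first by apply: cvgB; [exact: cvg_cst|exact: fst_continuous].
    by apply: cvg_comp; [exact: snd_continuous|exact: cphi].
  apply: cvgM; first exact: fst_continuous.
  by apply: cvg_comp; [exact: snd_continuous|exact: cpsi].
move=> [s t] /= []; rewrite !in_itv /= => s01 t01.
have [p01 _] := hphi _ t01; have [q01 _] := hpsi _ t01.
by apply/andP; split; nra.
Qed.

End PathHomotopy.

(** * Null chains give elements of the delta-subgroup *)

Section PathAlgebra.
Variables (R : realType) (T : topologicalType).
Implicit Types (f g h k m : R -> T) (x y z w : T).

Lemma path_ends x y f : is_path x y f -> f 0 = x /\ f 1 = y.
Proof. by case. Qed.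

Lemma hpath_assoc x y z w f g h : is_path x y f -> is_path y z g ->
  is_path z w h ->
  hpath x w (path_cat f (path_cat g h)) (path_cat (path_cat f g) h).
Proof.
move=> pf pg ph; pose F := path_cat (path_cat f g) h.
have pF : is_path x w F by apply: is_path_cat ph; apply: is_path_cat pf pg.
have pG : is_path x w (path_cat f (path_cat g h)).
  by apply: is_path_cat pf _; apply: is_path_cat pg ph.
apply: (@hpath_reparam _ _ x w x w F _ _
  (* The change of parameter between the two bracketings is convex and piecewise affine, with slopes
     1/2, 1 and 2, hence a maximum of affine maps. *)
  (fun t => Num.max (2^-1 * t + 0) (Num.max (1 * t + - 4^-1) (2 * t + -1)))
    (fun t => 1 * t + 0)) => //.
- by do 2?[apply: max_continuous]; exact: affine_continuous.
- exact: affine_continuous.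
- move=> t t01; have [t1|t1] := leP t 2^-1.
    rewrite [Num.max (1 * t + _) _]max_l; last by lra.
    rewrite max_l; last by lra.
    split; first lra.
    rewrite /F /path_cat t1 ifT; last by lra.
    rewrite ifT; last by lra.
    by congr f; lra.
  have [t2|t2] := leP t (3 / 4).
    rewrite [Num.max (1 * t + _) _]max_l; last by lra.
    rewrite max_r; last by lra.
    split; first lra.
    rewrite /F /path_cat ifF; last by lra.
    rewrite ifT; last by lra.
    rewrite ifT; last by lra.
    rewrite ifF; last by lra.
    by congr g; lra.
  rewrite [Num.max (1 * t + _) _]max_r; last by lra.
  rewrite max_r; last by lra.
  split; first lra.
  rewrite /F /path_cat ifF; last by lra.
  rewrite ifF; last by lra.
  rewrite ifF; last by lra.
  by congr h; lra.
- by move=> t t01; rewrite mul1r addr0.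
- by rewrite [Num.max (1 * 0 + _) _]max_l ?max_l; lra.
- by rewrite [Num.max (1 * 1 + _) _]max_r ?max_r; lra.
- by have [] := path_ends pG.
- by have [] := path_ends pG.
Qed.

Lemma hpath_revK x y z f m : is_path x y f -> is_path y z m ->
  hpath y z (path_cat (path_rev f) (path_cat f m)) m.
Proof.
move=> pf pm; have pF := is_path_cat pf pm.
have pG : is_path y z (path_cat (path_rev f) (path_cat f m)).
  by apply: is_path_cat pF; apply: is_path_rev.
apply: (@hpath_reparam _ _ y z x z (path_cat f m) _ _
  (* Both sides run along [path_cat f m]: the first goes from time 1/2 back to 0 and then forward to
     1, the second straight from 1/2 to 1. *)
  (fun t => Num.max (-1 * t + 2^-1) (2 * t + -1)) (fun t =>
    2^-1 * t + 2^-1)) => //.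
- by apply: max_continuous; exact: affine_continuous.
- exact: affine_continuous.
- move=> t t01; have [t1|t1] := leP t 2^-1.
    rewrite max_l; last by lra.
    split; first lra.
    rewrite {1}/path_cat t1 /path_rev /path_cat ifT; last by lra.
    by congr f; lra.
  rewrite max_r; last by lra.
  split; first lra.
  by rewrite {1}/path_cat ifF //; lra.
- move=> t t01; split; first lra.
  rewrite /path_cat; case: ifPn => [t1|]; last by move=> _; congr m; lra.
  have -> : t = 0 by lra.
  rewrite mulr0 add0r divff //.
  by have [-> _] := path_ends pm; have [_ ->] := path_ends pf.
- by rewrite max_l; lra.
- by rewrite max_r; lra.
- by have [] := path_ends pG.
- by have [] := path_ends pG.
Qed.

Lemma hpath_catr1 x y f : is_path x y f -> hpath x y (path_cat f (cst y)) f.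
Proof.
move=> pf; have pG := is_path_cat pf (@is_path_cst R _ y).
have [f0 f1] := path_ends pf.
apply: (@hpath_reparam _ _ x y x y f _ _
  (fun t => 1 + -1 * Num.max (-2 * t + 1) (0 * t + 0)) (fun t => 1 * t + 0)) =>
    //.
- have cm : continuous (fun t : R => Num.max (-2 * t + 1) (0 * t + 0)).
    by apply: max_continuous; exact: affine_continuous.
  move=> t; apply: cvgD; first exact: cvg_cst.
  by apply: cvgM; [exact: cvg_cst|exact: cm].
- exact: affine_continuous.
- move=> t t01; rewrite /path_cat; case: ifPn; rewrite -?ltNge => t1.
    rewrite max_l; last by lra.
    by split; [lra|congr f; lra].
  rewrite max_r; last by lra.
  split; first lra.
  by rewrite -f1; congr f; lra.
- by move=> t t01; rewrite mul1r addr0.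
- by rewrite max_l; lra.
- by rewrite max_r; lra.
- by have [] := path_ends pG.
- by have [] := path_ends pG.
Qed.

Lemma hpath_split x y f (a c : R) : is_path x y f -> 0 <= a -> a <= c ->
  c <= 1 ->
  hpath x (f c) (fun t => f (c * t + 0)) (path_cat (fun t =>
    f (a * t + 0)) (fun t => f ((c - a) * t + a))).
Proof.
move=> pf a0 ac c1; have [f0 f1] := path_ends pf.
apply: (@hpath_reparam _ _ x (f c) x y f _ _
  (fun t => c * t + 0)
  (fun t => (2 * a) * t + 0 + (c - 2 * a) * Num.max (2 * t + -1) (0 * t + 0)))
    => //.
- exact: affine_continuous.
- have cm : continuous (fun t : R => Num.max (2 * t + -1) (0 * t + 0)).
    by apply: max_continuous; exact: affine_continuous.
  move=> t; apply: cvgD; first exact: affine_continuous.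
  by apply: cvgM; [exact: cvg_cst|exact: cm].
- by move=> t /andP[t0 t1]; split=> //; rewrite addr0 mulr_ge0 ?mulr_ile1 //;
    lra.
- move=> t /andP[t0 t1]; rewrite /path_cat; case: ifPn; rewrite -?ltNge => t2.
    rewrite max_r; last by lra.
    split; last by congr f; lra.
    have h0 : 0 <= a * t by rewrite mulr_ge0.
    have h1 : a * t <= a * 2^-1 by rewrite ler_wpM2l.
    by lra.
  rewrite max_l; last by lra.
  split; last by congr f; lra.
  have h0 : 0 <= (c - a) * (2 * t - 1) by rewrite mulr_ge0 //; lra.
  have h1 : (c - a) * (2 * t - 1) <= (c - a) * 1 by rewrite ler_wpM2l //; lra.
  by lra.
- by rewrite max_r; lra.
- by rewrite max_l; lra.
- by rewrite mulr0 addr0.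
- by rewrite mulr1 addr0.
Qed.

Lemma is_path_sub x y f (a c : R) : is_path x y f -> 0 <= a -> a <= c ->
  c <= 1 ->
  is_path (f a) (f c) (fun t => f ((c - a) * t + a)).
Proof.
move=> pf a0 ac c1.
have := @is_path_comp R T x y f (fun t => (c - a) * t + a) pf
  (@affine_continuous R _ _).
rewrite mulr0 add0r mulr1 subrK; apply => t /andP[t0 t1].
have h0 : 0 <= (c - a) * t by rewrite mulr_ge0 //; lra.
have h1 : (c - a) * t <= (c - a) * 1 by rewrite ler_wpM2l //; lra.
by lra.
Qed.

End PathAlgebra.

(** * Cosets of the delta-subgroup, and geodesic polygons *)

Section DeltaSubgroup.
Variables (R : realType) (X : metricType R) (b : X) (d : R).
Hypothesis hgeo : geodesic X.
Implicit Types (f g h k : R -> X) (x y z w : X) (s : seq X).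

Local Notation D := (delta_subgroup b d).
Local Notation geo := (geo hgeo).

Lemma delta_hpath f g : hpath b b f g -> D f -> D g.
Proof. by move=> [pf pg fg]; apply: delta_homotopic. Qed.

(* [f] and [g] are in the same coset of the subgroup; testing them against    *)
(* every return path [k] keeps inverses of paths out of most proofs.          *)
Definition coset_eq x f g := [/\ is_path b x f, is_path b x g &
  forall k, is_path x b k -> D (path_cat f k) <-> D (path_cat g k)].

Lemma coset_refl x f : is_path b x f -> coset_eq x f f.
Proof. by split. Qed.

Lemma coset_sym x f g : coset_eq x f g -> coset_eq x g f.
Proof. by move=> [pf pg h]; split=> // k /h ->. Qed.

Lemma coset_trans g x f h : coset_eq x f g -> coset_eq x g h -> coset_eq x f h.
Proof. by move=> [pf pg fg] [_ ph gh]; split=> // k pk; rewrite fg ?gh. Qed.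

Lemma coset_hpath x f g : hpath b x f g -> coset_eq x f g.
Proof.
move=> fg; have [pf pg _] := fg; split=> // k pk.
have H := hpath_cat fg (hpath_refl pk).
by split; [exact: delta_hpath H|exact: delta_hpath (hpath_sym H)].
Qed.

Lemma coset_cat x y f g h : coset_eq x f g -> is_path x y h ->
  coset_eq y (path_cat f h) (path_cat g h).
Proof.
move=> [pf pg fg] ph; split; [exact: is_path_cat pf ph|exact: is_path_cat pg
  ph|].
move=> k pk; have := fg _ (is_path_cat ph pk).
have Hf := hpath_assoc pf ph pk; have Hg := hpath_assoc pg ph pk.
move=> [H1 H2]; split=> H.
  exact/(delta_hpath Hg)/H1/(delta_hpath (hpath_sym Hf)).
exact/(delta_hpath Hf)/H2/(delta_hpath (hpath_sym Hg)).
Qed.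

(* [f c' k] is homotopic to [(f c' c^-1 f^-1) (f c k)].                       *)
Lemma coset_ball x y z f c c' : is_path b x f -> is_path x y c ->
  is_path x y c' ->
  (forall t, 0 <= t <= 1 -> mdist z (c t) < d) ->
  (forall t, 0 <= t <= 1 -> mdist z (c' t) < d) ->
  coset_eq y (path_cat f c) (path_cat f c').
Proof.
move=> pf; suff key u v k : is_path x y u -> is_path x y v ->
    (forall t, 0 <= t <= 1 -> mdist z (u t) < d) ->
    (forall t, 0 <= t <= 1 -> mdist z (v t) < d) -> is_path y b k ->
    D (path_cat (path_cat f u) k) -> D (path_cat (path_cat f v) k).
  move=> pc pc' hc hc'; split; [exact: is_path_cat pf pc|exact: is_path_cat pf
    pc'|].
  by move=> k pk; split; apply: key.
move: u v => {}c {}c' pc pc' hc hc' pk Dk.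
have prc := is_path_rev pc; have prf := is_path_rev pf.
have pl : is_path x x (path_cat c' (path_rev c)) by apply: is_path_cat prc.
have gen : D (path_cat (path_cat f (path_cat c' (path_rev c))) (path_rev f)).
  apply: (@delta_gen _ _ _ _ x z) => // t t01; rewrite ballEmdist /= /path_cat.
  by case: ifPn; rewrite -?ltNge => t1; [apply: hc'|apply: hc]; lra.
apply: delta_hpath (delta_mul gen Dk).
have pck := is_path_cat pc pk; have pfl := is_path_cat pf pl.
have pc'k := is_path_cat pc' pk.
have pfck := is_path_cat pf pck.
have pfck' := is_path_cat (is_path_cat pf pc) pk.
apply: (@hpath_trans _ _ (path_cat (path_cat f (path_cat c' (path_rev c)))
                      (path_cat (path_rev f) (path_cat f (path_cat c k))))).
  apply: (@hpath_trans _ _ (path_cat (path_cat f (path_cat c' (path_rev c)))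
                      (path_cat (path_rev f) (path_cat (path_cat f c) k)))).
    exact/hpath_sym/(hpath_assoc pfl prf pfck').
  apply: hpath_cat (hpath_refl pfl) _; apply: hpath_cat (hpath_refl prf) _.
  exact/hpath_sym/(hpath_assoc pf pc pk).
apply: (@hpath_trans _ _ (path_cat (path_cat f (path_cat c' (path_rev c)))
  (path_cat c k))).
  exact: hpath_cat (hpath_refl pfl) (hpath_revK pf pck).
apply: (@hpath_trans _ _ (path_cat f (path_cat (path_cat c' (path_rev c))
  (path_cat c k)))).
  exact/hpath_sym/(hpath_assoc pf pl pck).
apply: (@hpath_trans _ _ (path_cat f (path_cat c' k)));
  last exact: hpath_assoc pf pc' pk.
apply: hpath_cat (hpath_refl pf) _.
apply: (@hpath_trans _ _ (path_cat c' (path_cat (path_rev c) (path_cat c k)))).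
  exact/hpath_sym/(hpath_assoc pc' prc pck).
exact: hpath_cat (hpath_refl pc') (hpath_revK pc pk).
Qed.

Lemma coset_delta f : coset_eq b f (cst b) -> D f.
Proof.
move=> [pf pb h]; apply: delta_hpath (hpath_catr1 pf) _.
apply/h => //; exact: delta_hpath (hpath_sym (hpath_catr1 pb)) (delta_one _ _).
Qed.

(* [f] is expected to end at [x].                                             *)
Fixpoint polygon x f s : R -> X :=
  if s is y :: s' then polygon y (path_cat f (geo x y)) s' else f.

Lemma polygon_path x f s : is_path b x f ->
  is_path b (last x s) (polygon x f s).
Proof. by elim: s x f => //= y s IH x f pf; apply: IH;
  apply: is_path_cat pf (geo_path _ _ _). Qed.

Lemma polygon_cat x f s1 s2 :
  polygon x f (s1 ++ s2) = polygon (last x s1) (polygon x f s1) s2.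
Proof. by elim: s1 x f => //=. Qed.

Lemma polygon_coset x f g s : coset_eq x f g ->
  coset_eq (last x s) (polygon x f s) (polygon x g s).
Proof.
by elim: s x f g => //= y s IH x f g fg; apply: IH; apply: coset_cat fg _;
  exact: geo_path.
Qed.

End DeltaSubgroup.

(** * From null chains to the delta-subgroup *)

Section NullDelta.
Variables (R : realType) (X : metricType R) (b : X) (r : R) (r0 : 0 < r).
Hypothesis hgeo : geodesic X.

Local Notation d := (3 / 2 * r).
Local Notation E := (eps_ent X r0).
Local Notation geo := (geo hgeo).
Local Notation polygon := (polygon hgeo).

Lemma triangle_coset x y w (f : R -> X) : is_path b x f ->
  mdist x y < r -> mdist x w < r -> mdist w y < r ->
  coset_eq b d y (path_cat f (geo x y)) (path_cat (path_cat f (geo x w)) (geo w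
    y)).
Proof.
move=> pf xy xw wy; have [[pxy pxw] pwy] := (geo_path hgeo x y,
  geo_path hgeo x w, geo_path hgeo w y).
apply: coset_trans (coset_hpath _ (hpath_assoc pf pxw pwy)).
apply: (@coset_ball _ _ _ _ x y x) => //; first exact: is_path_cat pxw pwy.
  by move=> t t01; have h := geo_distl hgeo x y t01; have r0' := r0; lra.
move=> t t01; rewrite /path_cat; case: ifPn; rewrite -?ltNge => t1.
  have t01' : 0 <= 2 * t <= 1 by lra.
  by have h := geo_distl hgeo x w t01'; have r0' := r0; lra.
have t01' : 0 <= 2 * t - 1 <= 1 by lra.
(* Going from [x] to [u] both ways round the triangle gives twice the distance at most the
   perimeter, which is below 3 * r. *)
have := geo_dist hgeo w y t01'; set u := geo w y _.
have h1 := metric_triangle x w u; have h2 := metric_triangle x y u.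
by rewrite (metric_sym y u) in h2; lra.
Qed.

(** An insertion replaces one side of a triangle by the other two, which [triangle_coset] allows
    inside a longer polygon; doubling [b] adds a geodesic loop from [b] to itself, which stays at
    [b]. *)
Lemma polygon_hom s t : ent_homotopic E s t -> head b s = b ->
  coset_eq b d (last b s) (polygon b (cst b) (behead s)) (polygon b (cst b)
    (behead t)).
Proof.
have pcst := @is_path_cst R X b.
have ref s' : head b s' = b -> is_path b (last b s') (polygon b (cst b) (behead
  s')).
  by case: s' => //= a s' ->; apply: polygon_path.
have er x y : ent_rel E x y -> mdist x y < r by move=> /ent_relP.
elim=> {s t} [s t|s hs|s t st IH|s t u st IH1 _ IH2 hs].
- move=> [cs ct [[u [w [v [u0 v0 es et]]]]|[x [es et]]]]; subst s t.
    case: u u0 cs ct => // a u _ cs ct /= ab; rewrite ab in cs ct *.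
    case: v v0 cs ct => // y v _; rewrite !cat_cons !ent_chain_cons !cat_path.
    rewrite last_cat !polygon_cat /= => /andP[_ /andP[xy _]] /and3P[_ xw
      /andP[wy _]].
    apply: polygon_coset; apply: triangle_coset;
      [exact: polygon_path|exact: er..].
  move=> /= xb; rewrite xb in cs ct *.
  apply: coset_trans (coset_hpath _ (hpath_sym (hpath_catr1 pcst))) _.
  apply: (@coset_ball _ _ _ _ b b b) => //; first exact: geo_path.
    by move=> t _; rewrite mdistxx mulr_gt0 // divr_gt0.
  move=> t t01; apply: le_lt_trans (geo_distl hgeo _ _ t01) _.
  by rewrite mdistxx mulr_gt0 // divr_gt0.
- exact/coset_refl/ref.
- have [h l] := hom_ends b st; move=> ht.
  by rewrite -l; apply/coset_sym/IH; rewrite h.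
- have [h l] := hom_ends b st.
  by apply: coset_trans (IH1 hs) _; rewrite l; apply: IH2; rewrite -h.
Qed.

(** Each small arc of [c] and the geodesic chord with the same ends lie in one ball about the sample
    point, so [coset_ball] exchanges them one by one. *)
Lemma polygon_disc c n x : is_path b x c -> fine_path r n c -> forall k,
  (k <= n)%N ->
  coset_eq b d (c (k%:R / n%:R)) (fun t => c (k%:R / n%:R * t + 0))
    (polygon b (cst b) (disc n c k)).
Proof.
move=> pc hc; have r0' := r0; have [c0 c1] := path_ends pc; elim=> [|k IH] kn.
  rewrite /disc /= (_ : (fun t => _) = cst b); first by rewrite mul0r c0;
    exact/coset_refl/is_path_cst.
  by apply/funext => t /=; rewrite !mul0r addr0 c0.
have kn' := ltnW kn; have /andP[a0 a1] := frac01 R kn';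
  have /andP[c'0 c'1] := frac01 R kn.
have ac : (k%:R / n%:R : R) <= k.+1%:R / n%:R.
  by rewrite ler_pM2r ?ler_nat // invr_gt0 ltr0n; case: hc.
apply: coset_trans (coset_hpath _ (hpath_split pc a0 ac c'1)) _.
have psub := is_path_sub pc a0 ac c'1.
apply: coset_trans (coset_cat (IH kn') psub) _.
rewrite /disc mkseqS -cats1 polygon_cat -/(disc n c k) -{3}c0 /=.
have := disc_lastE n c k; rewrite c0 => ->.
have fk := fine_step hc kn.
have [_ pf _] := IH kn'.
apply: (@coset_ball _ _ _ _ _ _ (c (k%:R / n%:R)) _ _ _ pf) => //;
  first exact: geo_path.
  move=> t t01; set u := _ * t + _.
  have h01 : 0 <= (k.+1%:R / n%:R - k%:R / n%:R) * t <= (k.+1%:R / n%:R - k%:R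
    / n%:R : R).
    have /andP[t0 t1] := t01; rewrite mulr_ge0 ?subr_ge0 //= -[leRHS]mulr1.
    by rewrite ler_wpM2l ?subr_ge0.
  apply: (@lt_trans _ _ r); last by lra.
  have [n0 hn] := hc; apply: hn => //; first by rewrite a0.
    by rewrite /u; lra.
  rewrite distrC /u addrK ger0_norm; last by case/andP: h01.
  case/andP: h01 => _ /le_trans; apply; rewrite -mulrBl -natr1 addrAC subrr
    add0r.
  by rewrite ler_pM2r ?ler1n // invr_gt0 ltr0n.
move=> t t01; apply: le_lt_trans (geo_distl hgeo _ _ t01) _.
by apply: lt_trans fk _; lra.
Qed.

Lemma null_delta c n : is_path b b c -> fine_path r n c ->
  ent_homotopic E (b :: disc n c n) [:: b] -> delta_subgroup b d c.
Proof.
move=> pc hc h; have n0 : (0 < n)%N by case: hc.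
have [c0 c1] := path_ends pc.
have := polygon_disc pc hc (leqnn n); rewrite divff ?pnatr_eq0 -?lt0n // c1.
rewrite (_ : (fun t => _) = c); last by apply/funext => t; rewrite mul1r addr0.
move=> h1; apply: coset_delta; apply: coset_trans h1 _.
have := polygon_hom h erefl; rewrite /=.
by have := disc_lastE n c n; rewrite c0 => ->;
  rewrite divff ?pnatr_eq0 -?lt0n // c1.
Qed.

End NullDelta.

(** * Elements of the delta-subgroup are null *)

Section NullLoops.
Variables (R : realType) (X : metricType R) (E : sym_entourage X) (b : X).
Implicit Types (c f h : R -> X) (q : ent_cover E b).

Local Notation e := (ent_rel E).
Local Notation p := (@ent_proj R X E b).
Local Notation q0 := (cls E b [::]).

Definition lifts_to (q q' : ent_cover E b) (c : R -> X) := exists2 h : R ->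
  ent_cover E b,
  is_path q q' h & forall t, 0 <= t <= 1 -> p (h t) = c t.

Lemma lifts_cat q1 q2 q3 f h : lifts_to q1 q2 f -> lifts_to q2 q3 h ->
  lifts_to q1 q3 (path_cat f h).
Proof.
move=> [k pk hk] [k' pk' hk']; exists (path_cat k k');
  first exact: is_path_cat pk pk'.
move=> t t01; rewrite /path_cat; case: ifPn; rewrite -?ltNge => t1;
  [apply: hk|apply: hk']; lra.
Qed.

Lemma lifts_rev q q' f : lifts_to q q' f -> lifts_to q' q (path_rev f).
Proof.
move=> [k pk hk]; exists (path_rev k); first exact: is_path_rev.
by move=> t t01; rewrite /path_rev; apply: hk; lra.
Qed.

Lemma lifts_exists x y q c : is_path x y c -> p q = x ->
  exists2 q', p q' = y & lifts_to q q' c.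
Proof.
move=> [cc c0 c1] qx; have [g g0 gE] := ent_eps E.
have [n hn] := fine_path_ex g0 cc; have [s ps qs] := cls_onto q.
have [|h [ch h0 hp h1]] := lift_exists gE cc hn ps;
  first by rewrite c0 -qx qs proj_cls.
exists (h 1); first by rewrite hp ?lexx ?ler01.
by exists h => //; split=> //; rewrite h0.
Qed.

Lemma lifts_unique q q1 q2 c : lifts_to q q1 c -> lifts_to q q2 c -> q1 = q2.
Proof.
have [g g0 gE] := ent_eps E.
move=> [h [ch h0 <-] hp] [k [ck k0 <-] kp]; apply: (lift_unique g0 gE) => //.
  by move=> t t01; rewrite hp // kp.
by rewrite h0 k0.
Qed.

(** The lift from the trivial class ends at the class of the sampled chain, and lifts are unique. *)
Lemma lifts_discP g n c : eps_entourage g `<=` ent_set E -> fine_path g n c ->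
  is_path b b c -> lifts_to q0 q0 c <-> ent_homotopic E (b :: disc n c n) [::
    b].
Proof.
move=> gE hn [cc c0 c1].
have pd : path e b (disc n c n) by have := path_disc gE hn (leqnn n);
  rewrite c0.
have c0' : last b [::] = c 0 by rewrite c0.
have [h [ch h0 hp h1]] := @lift_exists _ _ E b g gE c n [::] cc hn isT c0'.
rewrite -(cls_eqP pd) //; split=> [l|l].
  by apply: lifts_unique l; exists h.
by exists h => //; split=> //; rewrite h1.
Qed.

(** Regularity of the cover: a null chain appended to any chain ending at [b] does not change its
    class. *)
Lemma lifts_loop q c : is_path b b c -> p q = b -> lifts_to q0 q0 c ->
  lifts_to q q c.
Proof.
move=> pc qb l; have [cc c0 c1] := pc; have [g g0 gE] := ent_eps E.
have [n hn] := fine_path_ex g0 cc; have [s ps qs] := cls_onto q.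
have sb : last b s = b by rewrite -(proj_cls ps) -qs.
have [|h [ch h0 hp h1]] := lift_exists gE cc hn ps; first by rewrite sb c0.
have pd : path e b (disc n c n) by have := path_disc gE hn (leqnn n);
  rewrite c0.
exists h => //; split=> //; first by rewrite h0.
rewrite h1 qs; apply/cls_eqP => //; first by rewrite cat_path ps sb.
have := @hom_catl _ _ E (belast b s) (b :: disc n c n) [:: b].
rewrite -!cat_rcons cats0 (_ : rcons (belast b s) b = b :: s);
  last by rewrite [RHS]lastI sb.
apply; first exact/(lifts_discP gE hn).
by rewrite cat_cons ent_chain_cons cat_path ps sb.
Qed.

Lemma disc_eq n c f k : (forall t, 0 <= t <= 1 -> c t = f t) -> (k <= n)%N ->
  disc n c k = disc n f k.
Proof.
move=> cf kn; apply/eq_in_map => i; rewrite mem_iota add0n => /andP[_ ik].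
by apply: cf; apply: frac01; apply: leq_trans kn.
Qed.

(** The class [Z s] of the samples of the intermediate loop at time [s] is locally constant in [s]:
    between two close times the samples form a ladder whose triangles are all filled in [E]. *)
Lemma lifts_homotopic f h : is_path b b f -> is_path b b h ->
  path_homotopic b b f h ->
  lifts_to q0 q0 f -> lifts_to q0 q0 h.
Proof.
move=> pf ph [H [cH Hfh Hb]]; have [g g0 gE] := ent_eps E.
have g20 : 0 < g / 2 by rewrite divr_gt0.
have cI := @segment_compact R 0 1.
have [r r0 hr] := unif_cont (compact_setX cI cI) cH g20.
have r20 : 0 < r / 2 by rewrite divr_gt0.
have [n n0 nr] := unif_archi r20.
have hr' s s' t t' : 0 <= s <= 1 -> 0 <= s' <= 1 -> 0 <= t <= 1 ->
  0 <= t' <= 1 ->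
    `|s - s'| < r -> `|t - t'| < r -> mdist (H (s, t)) (H (s', t')) < g / 2.
  by move=> *; apply: hr; rewrite /= ?in_itv.
pose c s t := H (s, t).
have hn s : 0 <= s <= 1 -> fine_path (g / 2) n (c s).
  move=> s01; split=> // t t' t01 t'01 tt'; apply: hr' => //;
    first by rewrite subrr normr0.
  by apply: le_lt_trans tt' _; lra.
have hng s : 0 <= s <= 1 -> fine_path g n (c s).
  by move=> /hn; apply: fine_pathW; lra.
have pd s k : 0 <= s <= 1 -> (k <= n)%N -> path e b (disc n (c s) k).
  by move=> s01 kn; have := path_disc gE (hng _ s01) kn;
    rewrite {1}/c (Hb _ s01).1.
have pl s k : 0 <= s <= 1 -> (k <= n)%N -> p (cls E b (disc n (c s) k)) = c s
  (k%:R / n%:R).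
  move=> s01 kn; rewrite proj_cls ?pd //.
  by have := disc_lastE n (c s) k; rewrite {1}/c (Hb _ s01).1.
pose Z s := cls E b (disc n (c s) n).
have extS s k : 0 <= s <= 1 -> (k < n)%N ->
    cls E b (disc n (c s) k.+1) = ext (cls E b (disc n (c s) k)) (c s (k.+1%:R
      / n%:R)).
  move=> s01 kn; rewrite ext_cls ?pd 1?ltnW //; first by rewrite /disc mkseqS.
  rewrite -(proj_cls (pd _ _ s01 (ltnW kn))) pl 1?ltnW //.
  by apply: (eps_rel gE); apply: fine_step (hng _ s01) kn.
have ZZ : Z 0 = Z 1.
  apply: unit_loc_const => s s01; exists r => // s' s'01 ss'.
  suff A k : (k <= n)%N ->
      ext (cls E b (disc n (c s) k)) (c s' (k%:R / n%:R)) = cls E b (disc n (c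
        s') k).
    have := A n (leqnn n); rewrite divff ?pnatr_eq0 -?lt0n // /Z => <-.
    have -> : c s' 1 = p (cls E b (disc n (c s) n)); last by rewrite ext_id.
    rewrite pl // divff ?pnatr_eq0 -?lt0n // /c.
    by rewrite (Hb _ s'01).2 (Hb _ s01).2.
  rewrite distrC in ss'.
  elim: k => [|k IH] kn.
    by have := ext_id (cls E b [::]); rewrite proj_cls // mul0r /disc /= /c (Hb
      _ s'01).1.
  have kn' := ltnW kn; have k01 := frac01 R kn'; have k101 := frac01 R kn.
  have close t : 0 <= t <= 1 -> e (c s t) (c s' t).
    move=> t01; apply: (eps_rel gE); apply: (@lt_trans _ _ (g / 2));
      last by lra.
    by apply: hr'; rewrite ?subrr ?normr0.
  have d1 := fine_step (hn _ s01) kn; have d2 := fine_step (hn _ s'01) kn.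
  have d3 : mdist (c s (k%:R / n%:R)) (c s' (k%:R / n%:R)) < g / 2.
    by apply: hr'; rewrite ?subrr ?normr0.
  have tr := metric_triangle (c s (k%:R / n%:R)) (c s' (k%:R / n%:R)) (c s'
    (k.+1%:R / n%:R)).
  (* The diagonal of a grid cell is bounded by two edges below g / 2, the reason for halving [g]. *)
  have e13 : e (c s (k%:R / n%:R)) (c s' (k.+1%:R / n%:R)) by apply: (eps_rel
    gE); lra.
  rewrite !extS // -IH // !ext_ext ?pl ?close //.
  - by apply: (eps_rel gE); lra.
  - by apply: (eps_rel gE); lra.
have l01 : 0 <= (0 : R) <= 1 by rewrite lexx ler01.
have r01 : 0 <= (1 : R) <= 1 by rewrite lexx ler01.
have dE s k : 0 <= s <= 1 -> (forall t, 0 <= t <= 1 -> c s t = k t) ->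
  is_path b b k ->
    fine_path g n k -> lifts_to q0 q0 k <-> Z s = q0.
  move=> s01 ck pk hk; rewrite (lifts_discP gE hk) // -(disc_eq ck) // /Z.
  by rewrite cls_eqP ?pd.
have fE k s : 0 <= s <= 1 -> (forall t, 0 <= t <= 1 -> c s t = k t) ->
  fine_path g n k.
  move=> s01 ck; have [_ h1] := hng _ s01; split=> // t t' t01 t'01 tt'.
  by rewrite -!ck //; apply: h1.
have f0 t : 0 <= t <= 1 -> c 0 t = f t by move=> /Hfh[].
have h1 t : 0 <= t <= 1 -> c 1 t = h t by move=> /Hfh[].
move=> /(dE 0 f l01 f0 pf (fE _ _ l01 f0)) Z0.
by apply/(dE 1 h r01 h1 ph (fE _ _ r01 h1)); rewrite -ZZ.
Qed.

End NullLoops.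

(** * The cover of [E_r] is the delta-cover *)

Section DeltaNull.
Variables (R : realType) (X : metricType R) (b : X) (r : R) (r0 : 0 < r).
Hypothesis hgeo : geodesic X.

Local Notation d := (3 / 2 * r).
Local Notation E := (eps_ent X r0).
Local Notation p := (@ent_proj R X E b).
Local Notation q0 := (cls E b [::]).

Lemma eps_ent_rel x y : mdist x y < r -> ent_rel E x y.
Proof. by move=> xy; apply/ent_relP. Qed.

(* Coning off the loop from [z] through the points [m w], two thirds of the   *)
(* way from [z] to [w], only uses triangles with sides shorter than [r].      *)
Lemma lifts_ball x z (l : R -> X) (q : ent_cover E b) : is_path x x l ->
  (forall t, 0 <= t <= 1 -> mdist z (l t) < d) -> p q = x -> lifts_to q q l.
Proof.
move=> pl hl qx; have [q' q'x [h [ch h0 h1] hp]] := lifts_exists pl qx.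
suff H : q' = q by rewrite -{2}H; exists h.
have [cl l0 l1] := pl; have r0' := r0.
pose m w := projT1 (cid (geo_two_thirds hgeo z w)).
have zm w : mdist z (m w) <= 2 / 3 * mdist z w by rewrite /m; case: cid => ? [].
have mw w : mdist (m w) w <= mdist z w / 3 by rewrite /m; case: cid => ? [].
(* The point over the centre seen from [h t]. It determines [h t] back ([hZ]), so the lift closes up
   once [Z] is shown locally constant. *)
pose Z t := ext (ext (h t) (m (l t))) z.
have r1 w : mdist z w < d -> ent_rel E w (m w).
  by move=> zw; apply: eps_ent_rel; rewrite metric_sym; have := mw w; lra.
have r2 w : mdist z w < d -> ent_rel E (m w) z.
  by move=> zw; apply: eps_ent_rel; rewrite metric_sym; have := zm w; lra.
have hZ t : 0 <= t <= 1 -> h t = ext (ext (Z t) (m (l t))) (l t).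
  move=> t01; have zt := hl _ t01; rewrite /Z.
  have pm : p (ext (h t) (m (l t))) = m (l t) by rewrite proj_ext // hp // r1.
  rewrite -{2}pm ext_back ?pm ?r2 // -{2}hp // ext_back // hp // r1 //.
suff ZZ : Z 0 = Z 1.
  rewrite -h1 -h0 [LHS]hZ ?lexx ?ler01 // [RHS]hZ ?lexx ?ler01 // l0 l1.
  by rewrite -ZZ.
apply: unit_loc_const => t t01; have zt := hl _ t01.
(* With D the distance from [z] to [l t] and a the move of [l], the two cone points are within 2/3 *
   D + 4/3 * a, which is below 2/3 * d = r when a < (d - D) / 2. *)
have g0 : 0 < Num.min r ((d - mdist z (l t)) / 2) by rewrite lt_min r0 divr_gt0
  // subr_gt0.
have gE : eps_entourage r `<=` ent_set E by [].
have [r' r'0 hr'] := lift_local r0 gE ch t01 g0.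
exists r' => // s s01 /(hr' _ s01)[]; rewrite !hp // lt_min =>
  /andP[dst1 dst2] es.
have zs := hl _ s01; have D0 := mdist_ge0 z (l t).
have tr1 := metric_triangle z (l t) (l s).
have tr2 := metric_triangle (l t) (l s) (m (l s)).
have tr3 := metric_triangle (m (l t)) (l t) (m (l s)).
have := mw (l t); have := mw (l s); rewrite (metric_sym (m (l s)) (l s)) =>
  m1 m2.
have e1 : ent_rel E (l t) (m (l s)) by apply: eps_ent_rel; lra.
have e2 : ent_rel E (m (l t)) (m (l s)) by apply: eps_ent_rel; lra.
have e3 := eps_ent_rel dst1.
have pm : p (ext (h t) (m (l t))) = m (l t) by rewrite proj_ext // hp // r1.
have E1 : ext (h s) (m (l s)) = ext (ext (h t) (m (l t))) (m (l s)).
  by rewrite es !ext_ext ?hp ?r1.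
by rewrite /Z E1 ext_ext ?pm ?r2.
Qed.

Lemma delta_lifts f : delta_subgroup b d f -> is_path b b f /\ lifts_to q0 q0 f.
Proof.
have q0b : p q0 = b by rewrite proj_cls.
elim=> {f}.
- move=> x z alpha lambda pa pl hl; split.
    by apply: is_path_cat (is_path_cat pa pl) (is_path_rev pa).
  have [q1 q1x l1] := lifts_exists pa q0b.
  apply: lifts_cat (lifts_rev l1); apply: lifts_cat l1 _.
  apply: (@lifts_ball x z) => // t /hl; rewrite ballEmdist; exact.
- split; first exact: is_path_cst.
  by exists (cst q0) => //; exact: is_path_cst.
- move=> f g _ [pf lf] _ [pg lg]; split; first exact: is_path_cat pf pg.
  exact: lifts_cat lf lg.
- move=> f _ [pf lf]; split; first exact: is_path_rev.
  exact: lifts_rev.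
- move=> h f ph _ [pf lf]; split; first exact: is_path_cat (is_path_cat ph pf)
    (is_path_rev ph).
  have [q1 q1b l1] := lifts_exists ph q0b.
  by apply: lifts_cat (lifts_rev l1); apply: lifts_cat l1 _; apply: lifts_loop.
- move=> f g pf pg fg _ [_ lf]; split=> //.
  exact: lifts_homotopic lf.
Qed.

Lemma lifts_delta f : is_path b b f -> lifts_to q0 q0 f -> delta_subgroup b d f.
Proof.
move=> pf lf; have [cf _ _] := pf; have [n hn] := fine_path_ex r0 cf.
have gE : eps_entourage r `<=` ent_set E by [].
by apply: (null_delta hgeo pf hn); apply/(lifts_discP gE hn).
Qed.

(** The loops that lift to closed loops at the trivial class are identified with the subgroup by
    [delta_lifts] and [lifts_delta]; homotopies only relate a loop to the projection of its lift. *)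
Lemma delta_cover : is_delta_cover b d p.
Proof.
split.
- exact: ent_proj_covering.
- exact: eps_cover_connected.
exists q0; first by rewrite proj_cls.
move=> f pf; split.
  move=> /delta_lifts[_ [h ph hf]]; exists h => //.
  have pc : is_path b b (p \o h).
    by apply: is_path_eq pf => t t01; rewrite /= hf.
  by have [] := hpath_eq hf pc.
move=> [h [ch h0 h1] hf].
have pc : is_path b b (p \o h).
  split; rewrite /= ?h0 ?h1 ?proj_cls //.
  apply: (@within_comp _ _ _ _ setT _ _ ch) => //.
  apply: continuous_subspaceT; have gE : eps_entourage r `<=` ent_set E by [].
  exact: proj_continuous r0 gE.
apply: (delta_homotopic pc pf hf); apply: (lifts_delta pc).
by exists h.
Qed.

End DeltaNull.

(** * Finiteness of the set of covers *)

Section Nets.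
Variables (R : realType) (X : metricType R).

Lemma compact_net (r : R) : compact [set: X] -> 0 < r ->
  exists N : seq X, forall x, exists2 z, z \in N & mdist x z < r.
Proof.
move=> /compact_near_coveringP cX r0.
(* Finite lists directed by inclusion: near each point every list containing that point works, and
   compactness makes one list work everywhere. *)
pose F := filter_from setT (fun N0 : seq X =>
  [set N : seq X | {subset N0 <= N}]).
have FF : Filter F.
  apply: filter_from_filter; first by exists [::].
  move=> N1 N2 _ _; exists (N1 ++ N2) => // N h; split=> z zN; apply: h;
    by rewrite mem_cat zN ?orbT.
have [|N0 _ h] := cX _ F (fun N x => exists2 z, z \in N & mdist x z < r) FF.
  move=> x _; exists ([set y | mdist x y < r],
    [set N : seq X | {subset [:: x] <= N}]) => /=.
    by split; [apply/nbhs_distP; exists r|exists [:: x]].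
  move=> [y N] /= [xy xN]; exists x; last by rewrite metric_sym.
  by apply: xN; rewrite mem_head.
by exists N0 => x; apply: h.
Qed.

Definition step_rel (r : R) : rel X := fun x y => mdist x y < r.

Lemma step_ent_rel (r r' : R) (E : sym_entourage X) : r <= r' ->
  eps_entourage r' `<=` ent_set E -> subrel (step_rel r) (ent_rel E).
Proof. by move=> rr' rE x y xy; apply: (eps_rel rE);
  apply: lt_le_trans rr'. Qed.

End Nets.

(** * Shortening chains with a finite net *)

Section ShortChains.
Variables (R : realType) (X : metricType R) (r : R) (N : seq X).
Hypothesis netN : forall x, exists2 z, z \in N & mdist x z < r / 3.

Definition net_point (x : X) : X := projT1 (cid2 (netN x)).

Lemma net_point_in x : net_point x \in N.
Proof. by rewrite /net_point; case: cid2. Qed.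

Lemma net_point_dist x : mdist x (net_point x) < r / 3.
Proof. by rewrite /net_point; case: cid2. Qed.

Local Notation nu := net_point.

(* A chain in [B] is shortened by removing the loops of the chain of its net  *)
(* points.                                                                    *)
Lemma short_chain (B : set X) x s : path (step_rel (r / 3)) x s ->
  (forall z, z \in x :: s -> B z) ->
  exists t, [/\ path (step_rel r) x t, last x t = last x s,
    (size t <= (size N).+1)%N & forall z, z \in t -> B z].
Proof.
move=> ps hB.
(* Edges between net points remember that they come from points of [B], so that after loop removal
   the chain can be realised in [B] again, with steps below three times r / 3. *)
pose e' : rel X := fun l l' =>
  `[< exists u v, [/\ B u, B v, nu u = l, nu v = l' & mdist u v < r / 3] >].
have pe : path e' (nu x) (map nu s).
  elim: s x ps hB => //= y s IH x /andP[xy py] hB; apply/andP; split.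
    apply/asboolP; exists x, y; split=> //; apply: hB;
      rewrite !inE eqxx ?orbT //.
  by apply: IH => // z zs; apply: hB; rewrite inE zs orbT.
have Bx : B x by apply: hB; rewrite mem_head.
have By : B (last x s) by apply: hB; apply: mem_last.
have : last (nu x) (map nu s) = nu (last x s) by rewrite last_map.
case/shortenP: pe => p' pp up sub lp.
have szp : (size p' <= size N)%N.
  apply: uniq_leq_size => [|z /sub /mapP[w _ ->]]; last exact: net_point_in.
  by case/andP: up.
have real l u (q : seq X) : path e' l q -> B u -> nu u = l ->
    exists t, [/\ path (step_rel r) u t, size t = size q,
      nu (last u t) = last l q &
      forall z, z \in t -> B z].
  elim: q l u => [|l' q IH] l u /=; first by move=> _ _ ul; exists [::].
  case/andP => /asboolP[u0 [v [Bu0 Bv u0l vl' u0v]]] pq Bu ul.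
  have [t [pt st lt Bt]] := IH _ _ pq Bv vl'.
  exists (v :: t); split=> //=; rewrite ?st //.
    rewrite pt andbT /step_rel.
    have d1 := net_point_dist u; have d2 := net_point_dist u0.
    rewrite ul in d1; rewrite u0l metric_sym in d2.
    have t1 := metric_triangle u l v; have t2 := metric_triangle l u0 v; lra.
  by move=> z; rewrite inE => /orP[/eqP ->|/Bt].
have [t [pt st lt Bt]] := real _ _ _ pp Bx erefl.
exists (rcons t (last x s)); split.
- rewrite rcons_path pt /step_rel /=.
  have d1 := net_point_dist (last x t); have d2 := net_point_dist (last x s).
  rewrite lt lp in d1; rewrite metric_sym in d2.
  have t1 := metric_triangle (last x t) (nu (last x s)) (last x s).
  have := mdist_ge0 (last x t) (nu (last x s)); lra.
- by rewrite last_rcons.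
- by rewrite size_rcons st ltnS.
- by move=> z; rewrite mem_rcons inE => /orP[/eqP ->|/Bt].
Qed.

End ShortChains.

(** * Homotopies between nearby chains *)

Section Transport.
Variables (R : realType) (X : metricType R) (E : sym_entourage X).

Local Notation e := (ent_rel E).
Local Notation hom := (ent_homotopic E).

Lemma hom_comp x s s' t t' : path e x s -> path e (last x s) t ->
  hom (x :: s) (x :: s') -> hom (last x s :: t) (last x s :: t') ->
  hom (x :: s ++ t) (x :: s' ++ t').
Proof.
move=> ps pt hs ht.
have c : ent_chain E ((x :: s) ++ t) by rewrite /= ent_chain_cons cat_path ps.
apply: hom_trans (hom_catr hs c) _.
have [_ ls] := hom_ends x hs; rewrite /= in ls.
have cs' : path e x s' by apply/ent_chain_cons/(hom_chain hs)/ent_chain_cons.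
have := @hom_catl _ _ E (belast x s') _ _ ht.
rewrite ls -!cat_rcons -lastI; apply.
by rewrite /= ent_chain_cons cat_path cs' -ls.
Qed.

Lemma hom_close (I : Type) (f g : I -> X) i l : (forall j, e (f j) (g j)) ->
  path (fun i j => [&& e (f i) (f j), e (g i) (g j) & e (f i) (g j)]) i l ->
  hom (f i :: g i :: map g l) (f i :: map f l ++ [:: g (last i l)]).
Proof.
move=> fg; elim: l i => [|j l IH] i /=; first by move=> _; exact: hom_refl.
case/andP => /and3P[fij gij fgij] pl.
have pg : path e (g j) (map g l).
  by rewrite path_map; apply: sub_path pl => u v /= /and3P[].
apply: (@hom_trans _ _ _ [:: f i, g j & map g l]).
  by apply: (@hom_del _ _ _ [::]) => //; apply/ent_chain_cons;
    rewrite /= fg gij.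
apply: (@hom_trans _ _ _ [:: f i, f j, g j & map g l]).
  by apply: hom_sym; apply: (@hom_del _ _ _ [::]) => //; apply/ent_chain_cons;
    rewrite /= fij fg.
apply: (@hom_catl _ _ _ [:: f i]); first exact: IH.
by apply/ent_chain_cons; rewrite /= fij fg.
Qed.

(** By the ladder of [hom_close], the loop of [g] is the loop of [f] conjugated by the edge from
    [g i] to [f i]. *)
Lemma hom_transport (I : Type) (f g : I -> X) i l : (forall j, e (f j) (g j)) ->
  path (fun i j => [&& e (f i) (f j), e (g i) (g j) & e (f i) (g j)]) i l ->
  g (last i l) = g i ->
  hom (f i :: map f l) [:: f i] -> hom (g i :: map g l) [:: g i].
Proof.
move=> fg pl gl hf.
have pg : path e (g i) (map g l).
  by rewrite path_map; apply: sub_path pl => u v /= /and3P[].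
have c0 : ent_chain E ([:: g i] ++ [:: f i, g i & map g l]).
  by apply/ent_chain_cons; rewrite /= fg ent_rel_sym fg.
apply: (@hom_trans _ _ _ [:: g i, f i, g i & map g l]).
  apply: hom_sym; apply: (@hom_trans _ _ _ [:: g i, g i & map g l]).
    by apply: (@hom_del _ _ _ [::]) => //; exact: ent_rel_refl.
  by apply: (@hom_dup _ _ _ [::]); apply/ent_chain_cons.
have h1 := hom_catl (hom_close fg pl) c0.
apply: hom_trans h1 _; rewrite gl.
have pf : path e (f i) (map f l).
  by rewrite path_map; apply: sub_path pl => u v /= /and3P[].
apply: (@hom_trans _ _ _ [:: g i; f i; g i]).
  apply: (@hom_catW _ _ _ [:: g i] _ _ [:: g i] hf).
  apply/ent_chain_cons; rewrite /= ent_rel_sym fg cat_path pf /= andbT.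
  have [_ /= ->] := hom_ends (f i) hf; exact: fg.
apply: (@hom_trans _ _ _ [:: g i; g i]).
  by apply: hom_triangle; rewrite ?ent_rel_refl // ent_rel_sym.
by apply: (@hom_dup _ _ _ [::]); apply/ent_chain_cons.
Qed.

End Transport.

(** * A finite invariant of entourage covers *)

Section Spectrum.
Variables (R : realType) (X : metricType R) (b : X) (r : R) (r0 : 0 < r) (N :
  seq X).
Hypothesis netN : forall x, exists2 z, z \in N & mdist x z < r / 3.

Local Notation M := (size N).+1.
(** The boundary of a triangle whose three sides are refined to at most [M] steps each has at most 3
    * M steps, hence one more point. *)
Local Notation K := (3 * M).+1.
Local Notation nu := (net_point netN).
Local Notation step := (@step_rel R X r).

(* The finite invariant that determines the cover of [E], when [E] is chained *)
(* and contains all pairs at distance less than [3 * r].                      *)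
Definition net_null (E : sym_entourage X) : {set K.-bseq (seq_sub N)} :=
  [set c : K.-bseq (seq_sub N) |
    `[< ent_homotopic E (map val c) [:: head b (map val c)] >] ]%SET.

Lemma net_bseq (s : seq X) : (size s <= K)%N -> {subset s <= N} ->
  exists c : K.-bseq (seq_sub N), map val c = s.
Proof.
move=> sK sN; have [c cs] : exists c : seq (seq_sub N), map val c = s.
  elim: s sN {sK} => [|x s IH] sN; first by exists [::].
  have [|c cs] := IH; first by move=> z zs; apply: sN; rewrite inE zs orbT.
  by exists (SeqSub (sN x (mem_head _ _)) :: c); rewrite /= cs.
have sz : (size c <= K)%N by rewrite -(size_map val) cs.
by exists (Bseq sz).
Qed.

Section TwoEntourages.
Variables E E' : sym_entourage X.
Hypotheses (rE : eps_entourage (3 * r) `<=` ent_set E)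
  (rE' : eps_entourage (3 * r) `<=` ent_set E').
Hypothesis cE : chained E.

Lemma step3 : r <= 3 * r. Proof. by have := r0; lra. Qed.

Let stepE : subrel step (ent_rel E) := step_ent_rel step3 rE.
Let stepE' : subrel step (ent_rel E') := step_ent_rel step3 rE'.

(** Chainedness supplies an r / 3-chain inside the [E]-ball of [x]; [short_chain] bounds its length
    without leaving that ball. *)
Lemma refine_exists x y : ent_rel E x y -> exists s, [/\ path step x s,
  last x s = y,
  (size s <= M)%N & {in s, forall z, ent_rel E x z}].
Proof.
move=> xy; have r30 : 0 < r / 3 by rewrite divr_gt0.
have [_ /(_ x y (eps_ent X r30))] := cE; case; first exact/ent_relP.
move=> s [/ent_chain_cons ps ls hs].
have ps' : path (step_rel (r / 3)) x s by apply: sub_path ps => u v /ent_relP.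
have [|t [pt lt st ht]] := @short_chain _ _ _ _ netN (ent_ball E x) x s ps'.
  by move=> z /hs[].
by exists t; split=> //; [rewrite lt|move=> z /ht ?; apply/ent_relP].
Qed.

Definition arc x y : seq X :=
  if pselect (ent_rel E x y) is left h then projT1 (cid (refine_exists h)) else
    [::].

Lemma arcP x y : ent_rel E x y -> [/\ path step x (arc x y),
  last x (arc x y) = y,
  (size (arc x y) <= M)%N & {in arc x y, forall z, ent_rel E x z}].
Proof. by rewrite /arc => xy; case: pselect => // h; case: cid. Qed.

Fixpoint refine x s : seq X := if s is y :: s' then arc x y ++ refine y s' else
  [::].

Lemma refine_cat x s t : refine x (s ++ t) = refine x s ++ refine (last x s) t.
Proof. by elim: s x => //= y s IH x; rewrite IH catA. Qed.

Lemma refine_path x s : path (ent_rel E) x s ->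
  path step x (refine x s) /\ last x (refine x s) = last x s.
Proof.
elim: s x => //= y s IH x /andP[/arcP[pa la _ _] /IH[pr lr]].
by rewrite cat_path last_cat la pa.
Qed.

Lemma arc_hom x y : ent_rel E x y -> ent_homotopic E (x :: arc x y) [:: x; y].
Proof.
move=> /arcP[pa la _ ha]; rewrite -{2}la; apply: hom_collapse => //.
exact: sub_path pa.
Qed.

Lemma refine_hom x s : path (ent_rel E) x s ->
  ent_homotopic E (x :: refine x s) (x :: s).
Proof.
elim: s x => [|y s IH] x /=; first by move=> _; exact: hom_refl.
case/andP => xy ps; have [pa la _ _] := arcP xy; have [pr _] := refine_path ps.
apply: (@hom_comp _ _ E x (arc x y) [:: y]); rewrite ?la //.
- exact: sub_path pa.
- exact: sub_path pr.
- exact: arc_hom.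
- exact: IH.
Qed.

Hypothesis nullEE' : net_null E \subset net_null E'.

Lemma net_path x s (F : sym_entourage X) : eps_entourage (3 * r) `<=` ent_set F
  ->
  path step x s ->
  path (fun i j => [&& ent_rel F i j, ent_rel F (nu i) (nu j) &
    ent_rel F i (nu j)]) x s /\
  path (fun i j => [&& ent_rel F (nu i) (nu j), ent_rel F i j &
    ent_rel F (nu i) j]) x s.
Proof.
move=> rF ps; have r0' := r0.
split; apply: sub_path ps => u v; rewrite /step_rel => uv;
  have d1 := net_point_dist netN u; have d2 := net_point_dist netN v;
  have t1 := metric_triangle (nu u) u v; have t2 := metric_triangle u v (nu v);
  have t3 := metric_triangle (nu u) v (nu v);
    rewrite (metric_sym (nu u) u) in t1;
  by apply/and3P; split; apply: (eps_rel rF); lra.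
Qed.

(** The loop is moved to the net within [E], recognised there by [net_null], and moved back within
    [E']. The moves involve distances below r + 2 * (r / 3), covered by the margin 3 * r. *)
Lemma null_transfer x s : path step x s -> last x s = x -> (size s < K)%N ->
  ent_homotopic E (x :: s) [:: x] -> ent_homotopic E' (x :: s) [:: x].
Proof.
move=> ps ls sK h; have r0' := r0.
have [c cs] : exists c : K.-bseq (seq_sub N), map val c = map nu (x :: s).
  apply: net_bseq; first by rewrite size_map.
  by move=> z /mapP[w _ ->]; exact: net_point_in.
have clo F z : eps_entourage (3 * r) `<=` ent_set F -> ent_rel F z (nu z).
  by move=> rF; apply: (eps_rel rF); have := net_point_dist netN z; lra.
have : c \in net_null E.
  rewrite inE cs; apply/asboolP.
  apply: (@hom_transport _ _ E X id nu) => //; rewrite ?map_id ?ls //.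
    by move=> z; apply: clo.
  by case: (net_path rE ps).
move=> /(fintype.subsetP nullEE'); rewrite inE cs => /asboolP h'.
have := @hom_transport _ _ E' X nu id x s; rewrite map_id; apply => //.
  by move=> z; rewrite ent_rel_sym; apply: clo.
by case: (net_path rE' ps).
Qed.

Lemma short_transfer x s t : path step x s -> path step x t ->
  last x s = last x t ->
  (size s + size t < K)%N ->
  ent_homotopic E (x :: s) (x :: t) -> ent_homotopic E' (x :: s) (x :: t).
Proof.
move=> ps pt st sz.
have [psE ptE] := (sub_path stepE ps, sub_path stepE pt).
have [psE' ptE'] := (sub_path stepE' ps, sub_path stepE' pt).
move=> /(hom_loopP psE ptE st) h; apply/(hom_loopP psE' ptE' st);
  apply: null_transfer h.
- rewrite cat_path ps st rev_path; apply: sub_path pt => u v.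
  by rewrite /step_rel metric_sym.
- by rewrite last_cat st last_rev_belast.
- by rewrite size_cat size_rev size_belast.
Qed.

Lemma step_refine x s : path step x s -> ent_homotopic E' (x :: s) (x :: refine
  x s).
Proof.
elim: s x => [|y s IH] x /=; first by move=> _; exact: hom_refl.
case/andP => xy ps; have [pa la sa _] := arcP (stepE xy).
apply: (@hom_comp _ _ E' x [:: y] (arc x y)) => /=.
- by rewrite stepE'.
- exact: sub_path ps.
- apply: short_transfer => //=; first by rewrite xy.
    by rewrite add1n ltnS (leq_ltn_trans sa) // ltn_Pmull.
  by apply: hom_sym; apply: arc_hom; apply: stepE.
- exact: IH.
Qed.

(** An [E]-homotopy may use long pairs that are not in [E'], so it is refined first: each elementary
    move then changes the chain along a short [E]-null loop, which [short_transfer] makes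
    [E']-null. *)
Lemma refine_transfer s t : ent_homotopic E s t -> head b s = b ->
  ent_homotopic E' (b :: refine b (behead s)) (b :: refine b (behead t)).
Proof.
elim=> {s t} [s t|s hs|s t st IH|s t u st IH1 _ IH2 hs].
- move=> [cs ct [[u [w [v [u0 v0 es et]]]]|[x [es et]]]]; subst s t.
    case: u u0 cs ct => // a u _ cs ct /= ab; rewrite ab in cs ct *.
    case: v v0 cs ct => // y v _; rewrite !cat_cons !ent_chain_cons !cat_path.
    rewrite !refine_cat /= => /andP[pu /andP[xy pv]] /and3P[_ xw /andP[wy _]].
    set x := last b u in xy xw *.
    have [pru lru] := refine_path pu; have [prv lrv] := refine_path pv.
    have [pxy lxy sxy _] := arcP xy; have [pxw lxw sxw _] := arcP xw.
    have [pwy lwy swy _] := arcP wy.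
    apply: hom_comp; rewrite ?lru -/x.
    + exact: sub_path pru.
    + by rewrite cat_path lxy (sub_path stepE' pxy) (sub_path stepE' prv).
    + exact: hom_refl.
    rewrite catA; apply: hom_comp; rewrite ?lxy.
    + exact: sub_path pxy.
    + exact: sub_path prv.
    + apply: short_transfer => //.
      * by rewrite cat_path pxw lxw.
      * by rewrite last_cat lxw lwy.
      * by rewrite ltnS size_cat !mulSn mul0n addn0 !leq_add.
      apply: hom_trans (arc_hom xy) _; apply: hom_sym.
      apply: (@hom_trans _ _ _ [:: x; w; y]); last exact: hom_triangle.
      apply: (@hom_comp _ _ E x (arc x w) [:: w]); rewrite ?lxw.
      * exact: sub_path pxw.
      * exact: sub_path pwy.
      * exact: arc_hom.
      * exact: arc_hom.
    + exact: hom_refl.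
  move=> /= xb; rewrite xb in cs ct *; rewrite cats0.
  have bb := ent_rel_refl E b; have [pa la sa _] := arcP bb.
  apply: short_transfer => //=; first by rewrite add0n ltnS (leq_trans sa) //
    leq_pmull.
  apply: hom_sym; apply: hom_trans (arc_hom bb) _.
  by apply: (@hom_dup _ _ _ [::]); apply/ent_chain_cons.
- exact: hom_refl.
- by have [h l] := hom_ends b st; move=> ht; apply/hom_sym/IH; rewrite h.
- have [h l] := hom_ends b st.
  by apply: hom_trans (IH1 hs) _; apply: IH2; rewrite -h.
Qed.

Lemma step_transfer s t : path step b s -> path step b t ->
  ent_homotopic E (b :: s) (b :: t) -> ent_homotopic E' (b :: s) (b :: t).
Proof.
move=> ps pt /refine_transfer/(_ erefl) /= h.
apply: hom_trans (step_refine ps) _; apply: hom_trans h _.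
exact/hom_sym/step_refine.
Qed.

Lemma step_onto (q : ent_cover E b) : exists2 s, path step b s & q = cls E b s.
Proof.
have [s ps ->] := cls_onto q; have [pr _] := refine_path ps.
exists (refine b s) => //; apply/cls_eqP => //; first exact: sub_path pr.
exact/hom_sym/refine_hom.
Qed.

(** Every class contains a chain with steps below [r]; the map keeps that chain, and [step_transfer]
    makes the choice immaterial. Near [q] both the class and its image are obtained by appending one
    point, whence continuity. *)
Lemma cover_map : exists2 f : ent_cover E b -> ent_cover E' b, continuous f &
  forall s, path step b s -> f (cls E b s) = cls E' b s.
Proof.
pose f q := cls E' b (projT1 (cid2 (step_onto q))).
have fcls s : path step b s -> f (cls E b s) = cls E' b s.
  move=> ps; rewrite /f; case: cid2 => /= t pt ht.
  apply/cls_eqP; [exact: sub_path pt|exact: sub_path ps|].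
  apply: step_transfer => //; apply/cls_eqP => //;
    [exact: sub_path pt|exact: sub_path ps].
exists f => // q U /near_cover[r1 r10 hU]; have [s ps qs] := step_onto q.
have m0 : 0 < Num.min r1 r by rewrite lt_min r10.
have r30 : 0 < 3 * r by rewrite mulr_gt0.
apply: (cover_near r30 rE m0) => q'; rewrite lt_min => /andP[d1 d2] eq'.
have sq : last b s = ent_proj q by rewrite qs proj_cls //; exact: sub_path ps.
have ps' : path step b (rcons s (ent_proj q')) by rewrite rcons_path ps sq.
have q'E : q' = cls E b (rcons s (ent_proj q')).
  rewrite [LHS]eq' {1}qs ext_cls //; first exact: sub_path ps.
  by rewrite sq; apply: stepE.
have fq : f q = cls E' b s by rewrite qs fcls.
have fq' : f q' = cls E' b (rcons s (ent_proj q')) by rewrite q'E fcls // -q'E.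
have psE' := sub_path stepE' ps; have psE'2 := sub_path stepE' ps'.
apply: hU; rewrite fq fq' !proj_cls // last_rcons.
  by rewrite sq.
by rewrite ext_cls // sq; apply: stepE'.
Qed.

End TwoEntourages.

Lemma net_null_equiv (E E' : sym_entourage X) :
  eps_entourage (3 * r) `<=` ent_set E -> eps_entourage (3 * r) `<=` ent_set E'
    ->
  chained E -> chained E' -> net_null E = net_null E' ->
  cover_equiv (@ent_proj R X E b) (@ent_proj R X E' b).
Proof.
move=> rE rE' cE cE' SE.
have [|f cf hf] := cover_map rE rE' cE; first by rewrite SE.
have [|g cg hg] := cover_map rE' rE cE'; first by rewrite SE.
exists f, g; split=> // q.
- by have [s ps ->] := step_onto rE cE q; rewrite hf // hg.
- by have [s ps ->] := step_onto rE' cE' q; rewrite hg // hf.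
have [s ps ->] := step_onto rE cE q; rewrite /= hf // !proj_cls //.
  exact: sub_path (step_ent_rel step3 rE) _ _ ps.
exact: sub_path (step_ent_rel step3 rE') _ _ ps.
Qed.

End Spectrum.

(** * Comparison of the spectra *)

Section CoverEquivalence.
Variables (X Y Z W : topologicalType).

Lemma cover_equiv_refl (p : Y -> X) : cover_equiv p p.
Proof. by exists id, id; split=> // q; exact: cvg_id. Qed.

Lemma cover_equiv_sym (p : Y -> X) (q : Z -> X) : cover_equiv p q ->
  cover_equiv q p.
Proof.
by move=> [f [g [cf cg fK gK h]]]; exists g, f; split=> // z;
  rewrite /= -h /= gK.
Qed.

Lemma cover_equiv_trans (p : Y -> X) (q : Z -> X) (r : W -> X) :
  cover_equiv p q -> cover_equiv q r -> cover_equiv p r.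
Proof.
move=> [f [g [cf cg fK gK h]]] [f' [g' [cf' cg' fK' gK' h']]].
exists (f' \o f), (g \o g'); split.
- by move=> y; apply: continuous_comp; [exact: cf|exact: cf'].
- by move=> w; apply: continuous_comp; [exact: cg'|exact: cg].
- by move=> y /=; rewrite fK'.
- by move=> w /=; rewrite gK.
- by move=> y; rewrite /= -h /= -h'.
Qed.

End CoverEquivalence.

Section Spectra.
Variables (R : realType) (X : metricType R) (b : X).

Lemma sigma_eps (E : sym_entourage X) (r : R) : (r%:E < sigma E)%E ->
  eps_entourage r `<=` ent_set E.
Proof.
move=> /ereal_sup_gt[_ [e [_ eE] <-]]; rewrite lte_fin => re xy h.
by apply: eE; apply: lt_trans re.
Qed.

Lemma sigma_eps_ent (r : R) (r0 : 0 < r) : (r%:E <= sigma (eps_ent X r0))%E.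
Proof. by apply: ereal_sup_ubound; exists r => //; split. Qed.

Lemma cover_class_eq (E F : sym_entourage X) :
  cover_equiv (@ent_proj R X E b) (@ent_proj R X F b) ->
  ent_cover_class b E = ent_cover_class b F.
Proof.
move=> EF; apply/seteqP; split=> G [cG h]; split=> //.
  exact: cover_equiv_trans (cover_equiv_sym EF) h.
exact: cover_equiv_trans EF h.
Qed.

Lemma cover_classes_finite (e : R) : compact [set: X] -> 0 < e ->
  finite_set (cover_classes b e).
Proof.
(* So that 3 * r = e / 2 is strictly below [sigma E], as [sigma_eps] requires. *)
move=> cX e0; pose r := e / 6; have r0 : 0 < r by rewrite divr_gt0.
have r30 : 0 < r / 3 by rewrite divr_gt0.
have [N netN] := compact_net cX r30.
pose A := [set E : sym_entourage X | chained E /\ (e%:E <= sigma E)%E].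
have rA E : A E -> eps_entourage (3 * r) `<=` ent_set E.
  by move=> [_ eE]; apply: sigma_eps; apply: lt_le_trans eE;
    rewrite lte_fin /r; lra.
(* A class is recovered from the value of the invariant, so the classes lie in the image of a finite
   type; values that are not attained are sent to [set0]. *)
pose rep c := if pselect (exists2 E, A E & net_null b N E = c) is left h
  then ent_cover_class b (projT1 (cid2 h)) else set0.
apply: (@sub_finite_set _ _ (rep @` [set: _]));
  last exact/finite_image/finite_finset.
move=> _ [E AE <-]; exists (net_null b N E) => //.
rewrite /rep; case: pselect => [h|[]]; last by exists E.
case: cid2 => /= F AF FE; apply: cover_class_eq.
have [cE _] := AE; have [cF _] := AF.
by apply: (net_null_equiv r0 netN (rA _ AF) (rA _ AE)).
Qed.

(** The equivalence may move the trivial class to another point over [b]; [lifts_loop] provides a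
    closed lift there, and injectivity brings it back. *)
Lemma equiv_lifts (E F : sym_entourage X) (c : R -> X) :
  cover_equiv (@ent_proj R X E b) (@ent_proj R X F b) -> is_path b b c ->
  lifts_to (cls F b [::]) (cls F b [::]) c ->
    lifts_to (cls E b [::]) (cls E b [::]) c.
Proof.
move=> [f [g [cf cg fK gK h]]] pc lF.
have pE : ent_proj (cls E b [::]) = b by rewrite proj_cls.
have [q qb lE] := lifts_exists pc pE.
suff qE : q = cls E b [::] by rewrite -{2}qE.
rewrite -(fK q) -(fK (cls E b [::])); congr g.
have l1 : lifts_to (f (cls E b [::])) (f q) c.
  have [k [ck k0 k1] kp] := lE; exists (f \o k); last by move=> t /kp <-;
    rewrite -h.
  split; rewrite /= ?k0 ?k1 //; apply: (@within_comp _ _ _ _ setT _ _ ck) => //.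
  exact: continuous_subspaceT.
apply: lifts_unique l1 _; apply: lifts_loop pc _ lF.
by rewrite -[LHS]/((@ent_proj R X F b \o f) _) h.
Qed.

Lemma lifts_mono (E F : sym_entourage X) (c : R -> X) :
  ent_set E `<=` ent_set F -> is_path b b c ->
  lifts_to (cls E b [::]) (cls E b [::]) c ->
    lifts_to (cls F b [::]) (cls F b [::]) c.
Proof.
move=> EF pc; have [cc _ _] := pc; have [g g0 gE] := ent_eps E.
have [n hn] := fine_path_ex g0 cc.
move=> /(lifts_discP gE hn pc) h; apply/(lifts_discP (subset_trans gE EF) hn
  pc).
exact: hom_sub h.
Qed.

Lemma delta_subgroup_mono (d d' : R) f : d <= d' ->
  delta_subgroup b d f -> delta_subgroup b d' f.
Proof.
move=> dd'; elim=> {f}.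
- move=> x z a l pa pl hl; apply: (@delta_gen _ _ _ _ x z) => // t t01.
  exact: le_ball dd' _ (hl t t01).
- exact: delta_one.
- by move=> f g _ hf _ hg; exact: delta_mul.
- by move=> f _ hf; exact: delta_inv.
- by move=> h f ph _ hf; exact: delta_conj.
- by move=> f g pf pg fg _ hf; exact: delta_homotopic hf.
Qed.

Hypotheses (hgeo : geodesic X) (hcpt : compact [set: X]).

Lemma spectrum_new_class (d : R) (d0 : 0 < d) (e : R) : d < e ->
  (forall d', 3 / 2 * d < d' -> ~ delta_covers_equiv b (3 / 2 * d) d') ->
  ~ cover_classes b e (ent_cover_class b (eps_ent X d0)).
Proof.
move=> de hd [E [cE eE] hE].
have equiv : cover_equiv (@ent_proj R X (eps_ent X d0) b) (@ent_proj R X E b).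
  have : ent_cover_class b E E by split=> //; exact: cover_equiv_refl.
  by rewrite hE => -[].
(* Strictly above [d], to contradict [hd], and strictly below [sigma E], so that [E_m] lies in
   [E]. *)
pose m := (d + e) / 2; have m0 : 0 < m by rewrite /m; lra.
have mE : eps_entourage m `<=` ent_set E.
  by apply: sigma_eps; apply: lt_le_trans eE; rewrite lte_fin /m; lra.
apply: (hd (3 / 2 * m)); first by rewrite /m; lra.
have cov := delta_cover b d0 hgeo.
(* One and the same cover serves for both radii: loops of the larger subgroup lift closed to the
   cover of [E_m], hence to that of [E], hence to the equivalent cover of [E_d]. *)
exists _, _, (@ent_proj R X (eps_ent X d0) b), (@ent_proj R X (eps_ent X d0) b).
split=> //; last exact: cover_equiv_refl.
have [cp con [y yb hy]] := cov; split=> //; exists y => // f pf.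
split; last by move=> /(hy f pf); apply: delta_subgroup_mono; rewrite /m; lra.
move=> /(delta_lifts m0 hgeo)[_ lf]; apply/(hy f pf).
apply: (@lifts_delta R X b d d0 hgeo f pf); apply: (equiv_lifts equiv pf).
exact: (lifts_mono _ pf lf).
Qed.

Lemma NC_lt (d : R) (d0 : 0 < d) (e : R) : d < e ->
  (forall d', 3 / 2 * d < d' -> ~ delta_covers_equiv b (3 / 2 * d) d') ->
  (NC b e < NC b d)%N.
Proof.
move=> de hd.
have sub : cover_classes b e `<=` cover_classes b d.
  move=> _ [E [cE eE] <-]; exists E => //; split=> //.
  by apply: le_trans eE; rewrite lee_fin ltW.
have find := cover_classes_finite hcpt d0.
have fine := cover_classes_finite hcpt (lt_trans d0 de).
rewrite /NC; apply: finmap.fproper_ltn_card; rewrite finmap.fproperEneq.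
have := sub; rewrite fset_set_sub // => ->; rewrite andbT.
apply/eqP => /(fset_set_inj fine find) ed.
apply: (spectrum_new_class (d0 := d0) de hd); rewrite ed.
exists (eps_ent X d0) => //; split; first exact: eps_ent_chained.
exact: sigma_eps_ent.
Qed.

End Spectra.

Theorem theorem3 (R : realType) (X : metricType R) (b : X)
    (hgeo : geodesic X) (hcpt : compact [set: X]) :
  [set 2 / 3 * delta | delta in covering_spectrum b]
    `<=` extended_covering_spectrum b.
Proof.
move=> _ [d [d0 hd] <-].
have e0 : 0 < 2 / 3 * d by rewrite mulr_gt0 // divr_gt0.
have dE : 3 / 2 * (2 / 3 * d) = d by lra.
split=> // e de; apply: (NC_lt hgeo hcpt e0 de).
by rewrite dE.
Qed.
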